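(* For every two real antisymmetric $d\times d$ matrices $\Theta,\Theta'$, $$\mathrm d_{\mathrm{HR}}(u_\Theta,u_{\Theta'})\leq 28\,\|\Theta-\Theta'\|^{1/2}.$$
   Context: $\|\Theta-\Theta'\|$ is the operator norm. For a real antisymmetric $d\times d$ matrix $\Theta=(\theta_{k,\ell})$, $A_\Theta$ is the universal C*-algebra generated by unitaries $u_{\Theta,1},\dots,u_{\Theta,d}$ satisfying $u_{\Theta,\ell}u_{\Theta,k}=e^{i\theta_{k,\ell}}u_{\Theta,k}u_{\Theta,\ell}$ for all $k,\ell$, and $u_\Theta=(u_{\Theta,1},\dots,u_{\Theta,d})$. For $d$-tuples of unitaries write $u\sim v$ if there is a $*$-isomorphism $C^*(u)\to C^*(v)$ mapping $u_i\mapsto v_i$ for all $i$. For $X=(X_1,\dots,X_d)\in B(H)^d$, $\|X\|:=\max_i\|X_i\|$. Define $$\mathrm d_{\mathrm{HR}}(u,v)=\inf\{\|u'-v'\| : u',v'\in B(H)^d \text{ for some Hilbert space } H,\ u'\sim u,\ v'\sim v\}.$$ *)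

(* Defs.v *)
From HB Require Import structures.
From mathcomp Require Import all_boot all_order all_algebra.
From mathcomp Require Import complex ring lra.
From mathcomp Require Import all_classical all_reals all_analysis.
Set Implicit Arguments.
Unset Strict Implicit.
Unset Printing Implicit Defensive.
Import Order.TTheory GRing.Theory Num.Theory.
Import numFieldNormedType.Exports.
Local Open Scope classical_set_scope.
Local Open Scope complex_scope.
Local Open Scope ring_scope.

HB.mixin Record isHilbert (R : realType) H & CompleteNormedModule R[i] H := {
  dot : H -> H -> R[i];
  dot_linear : forall z, scalar (dot^~ z);
  dotC : forall x y, dot x y = (dot y x)^*%C;
  dotxx : forall x, dot x x = `|x| ^+ 2 }.

#[short(type="hilbertType")]
HB.structure Definition Hilbert (R : realType) :=
  {H of CompleteNormedModule R[i] H & isHilbert R H}.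

(* Unital C*-algebras, the zero algebra included.  The product is part of the
   mixin because Hierarchy Builder rejects a structure joining PzRing and
   NormedModule (declared after NumDomain); the ring structure, hence the
   notations 1 and *, is recovered from it below. *)
HB.mixin Record isCstarAlgebra (R : realType) A
    & CompleteNormedModule R[i] A := {
  cone : A;
  cmul : A -> A -> A;
  star : A -> A;
  cmulA : associative cmul;
  cmul1l : left_id cone cmul;
  cmul1r : right_id cone cmul;
  cmulDl : left_distributive cmul +%R;
  cmulDr : right_distributive cmul +%R;
  cscaleAl : forall (a : R[i]) x y, a *: cmul x y = cmul (a *: x) y;
  cscaleAr : forall (a : R[i]) x y, a *: cmul x y = cmul x (a *: y);
  cnormM : forall x y, `|cmul x y| <= `|x| * `|y|;
  starK : involutive star;
  starD : {morph star : x y / x + y};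
  starZ : forall (a : R[i]) x, star (a *: x) = a^*%C *: star x;
  cstarM : forall x y, star (cmul x y) = cmul (star y) (star x);
  cstar_id : forall x, `|cmul (star x) x| = `|x| ^+ 2 }.

#[short(type="cstarAlgType")]
HB.structure Definition CstarAlgebra (R : realType) :=
  {A of CompleteNormedModule R[i] A & isCstarAlgebra R A}.

Section CstarRing.
Variables (R : realType) (A : cstarAlgType R).

Let cmul0l : left_zero (0 : A) cmul.
Proof. by move=> x; apply: (addrI (cmul 0 x)); rewrite -cmulDl !addr0. Qed.

Let cmul0r : right_zero (0 : A) cmul.
Proof. by move=> x; apply: (addrI (cmul x 0)); rewrite -cmulDr !addr0. Qed.

HB.instance Definition _ := GRing.Nmodule_isPzSemiRing.Build A
  cmulA cmul1l cmul1r cmulDl cmulDr cmul0l cmul0r.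

End CstarRing.

Section RealNorm.
Variables (R : realType) (V : normedModType R[i]).
Implicit Types x y : V.

(* The norm of a module over R[i] is R[i]-valued; [nrm] is its value in R. *)
Definition nrm x : R := complex.Re `|x|.

Lemma nrmE x : `|x| = (nrm x)%:C.
Proof.
rewrite /nrm; have := normr_ge0 x; case: `|x| => a b.
by rewrite lecE /= => /andP[/eqP-> _].
Qed.

Lemma nrm_ge0 x : 0 <= nrm x.
Proof. by rewrite -lecR -nrmE normr_ge0. Qed.

Lemma nrm0 : nrm (0 : V) = 0.
Proof. by rewrite /nrm normr0. Qed.

Lemma nrmN x : nrm (- x) = nrm x.
Proof. by rewrite /nrm normrN. Qed.

Lemma nrmB x y : nrm (x - y) = nrm (y - x).
Proof. by rewrite /nrm distrC. Qed.

Lemma nrm_eq0 x : nrm x = 0 -> x = 0.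
Proof. by move=> x0; apply/normr0_eq0; rewrite nrmE x0. Qed.

Lemma nrmD x y : nrm (x + y) <= nrm x + nrm y.
Proof. by rewrite -lecR rmorphD /= -!nrmE ler_normD. Qed.

Lemma nrmZ (a : R[i]) x : nrm (a *: x) = complex.Re `|a| * nrm x.
Proof.
rewrite /nrm normrZ (nrmE x); case: `|a| => b c /=.
by rewrite mulr0 subr0.
Qed.

Lemma nrmZr (a : R) x : nrm (a%:C *: x) = `|a| * nrm x.
Proof. by rewrite nrmZ normc_def /= expr0n /= addr0 sqrtr_sqr. Qed.

Lemma near_nrm_lt (F : set_system V) (FF : Filter F) (z : V) :
  F --> z <-> forall e : R, 0 < e -> \forall x \near F, nrm (z - x) < e.
Proof.
split=> [/cvgrPdist_lt Fz e e0|Fz].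
  have := Fz e%:C; rewrite ltcR => /(_ e0); apply: filterS => x /=.
  by rewrite nrmE ltcR.
apply/cvgrPdist_lt => -[e f]; rewrite ltcE /= => /andP[/eqP-> /Fz].
by apply: filterS => x; rewrite nrmE ltcR.
Qed.

Lemma cauchy_nrm (F : set_system V) (FF : ProperFilter F) :
  (forall e : R, 0 < e -> exists x, \forall y \near F, nrm (x - y) < e) ->
  cauchy F.
Proof.
move=> Fc; apply/cauchyP => -[e f]; rewrite ltcE /= => /andP[/eqP-> /Fc[x Fx]].
exists x; apply: filterS Fx => y xy.
by rewrite -ball_normE /ball_ /= nrmE ltcR.
Qed.

Lemma cauchy_nrmP (F : set_system V) (FF : ProperFilter F) (e : R) :
  cauchy F -> 0 < e -> exists2 A, F A & forall x y, A x -> A y -> nrm (x - y) < e.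
Proof.
move=> /cauchyP Fc e0; have e2 : 0 < (e / 2)%:C by rewrite ltcR divr_gt0.
have [x Fx] := Fc _ e2; exists (ball x (e / 2)%:C) => // y z.
rewrite -!ball_normE /ball_ /= !nrmE !ltcR => xy xz.
rewrite -(subrKA x); apply: le_lt_trans (nrmD _ _) _.
by rewrite nrmB (splitr e) ltrD.
Qed.

End RealNorm.

Section HilbertTheory.
Variables (R : realType) (H : hilbertType R).
Implicit Types x y z : H.

Definition rdot x y : R := complex.Re (dot x y).

Lemma dotDl x y z : dot (x + y) z = dot x z + dot y z.
Proof. by have := dot_linear z 1 x y; rewrite scale1r mul1r. Qed.

Lemma dot0l z : dot 0 z = 0 :> R[i].
Proof. by apply: (addrI (dot 0 z)); rewrite -dotDl !addr0. Qed.

Lemma dotZl (a : R[i]) x z : dot (a *: x) z = a * dot x z.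
Proof. by have := dot_linear z a x 0; rewrite dot0l !addr0. Qed.

Lemma dotDr x y z : dot z (x + y) = dot z x + dot z y.
Proof. by rewrite dotC dotDl rmorphD /= -!dotC. Qed.

Lemma dotZr (a : R[i]) x z : dot z (a *: x) = a^*%C * dot z x.
Proof. by rewrite dotC dotZl rmorphM /= -dotC. Qed.

Lemma rdotC x y : rdot x y = rdot y x.
Proof. by rewrite /rdot dotC; case: (dot y x). Qed.

Lemma rdotDl x y z : rdot (x + y) z = rdot x z + rdot y z.
Proof. by rewrite /rdot dotDl raddfD. Qed.

Lemma rdotDr x y z : rdot z (x + y) = rdot z x + rdot z y.
Proof. by rewrite /rdot dotDr raddfD. Qed.

Lemma rdotZl (a : R) x z : rdot (a%:C *: x) z = a * rdot x z.
Proof. by rewrite /rdot dotZl; case: (dot x z) => b c /=; rewrite mul0r subr0. Qed.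

Lemma rdotZr (a : R) x z : rdot z (a%:C *: x) = a * rdot z x.
Proof. by rewrite rdotC rdotZl rdotC. Qed.

Lemma rdotNl x z : rdot (- x) z = - rdot x z.
Proof. by rewrite -scaleN1r -[- 1]/((- 1)) -(rmorphN1 (real_complex R)) rdotZl mulN1r. Qed.

Lemma rdotNr x z : rdot z (- x) = - rdot z x.
Proof. by rewrite rdotC rdotNl rdotC. Qed.

Lemma rdotxx x : rdot x x = nrm x ^+ 2.
Proof. by rewrite /rdot dotxx nrmE -rmorphXn. Qed.

Lemma rdot_le x y : rdot x y <= nrm x * nrm y.
Proof.
have [x0|x0] := eqVneq (nrm x) 0.
  by rewrite (nrm_eq0 x0) /rdot dot0l nrm0 mul0r.
have xp : 0 < nrm x by rewrite lt_neqAle eq_sym x0 nrm_ge0.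
have [y0|y0] := eqVneq (nrm y) 0.
  by rewrite (nrm_eq0 y0) rdotC /rdot dot0l nrm0 mulr0.
have yp : 0 < nrm y by rewrite lt_neqAle eq_sym y0 nrm_ge0.
have := sqr_ge0 (nrm ((nrm y)%:C *: x - (nrm x)%:C *: y)).
rewrite -rdotxx !(rdotDl, rdotDr, rdotNl, rdotNr, rdotZl, rdotZr) !rdotxx.
rewrite (rdotC y x) => h.
have {}h : 0 <= (2 * nrm x * nrm y) * (nrm x * nrm y - rdot x y).
  by apply: le_trans h _; rewrite le_eqVlt; apply/orP; left; apply/eqP; ring.
by move: h; rewrite pmulr_rge0 ?subr_ge0 // !mulr_gt0.
Qed.

Lemma dot_ext x y : (forall h, rdot h x = rdot h y) -> x = y.
Proof.
move=> e; apply/eqP; rewrite -subr_eq0; apply/eqP/nrm_eq0/eqP.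
by rewrite -sqrf_eq0 -rdotxx rdotDr rdotNr e subrr.
Qed.

Lemma Re_imul (w : R[i]) : complex.Re ('i%C * w) = - complex.Im w.
Proof. by case: w => a b /=; rewrite mul0r mul1r sub0r. Qed.

Lemma riesz (f : H -> R[i]) (M : R) : scalar f ->
  (forall x, complex.Re (f x) <= M * nrm x) -> exists z, forall x, f x = dot x z.
Proof.
move=> flin fM.
pose g x := complex.Re (f x).
have fD x y : f (x + y) = f x + f y.
  by have := flin 1 x y; rewrite scale1r mul1r.
have f0 : f 0 = 0 by apply: (addrI (f 0)); rewrite -fD !addr0.
have fZ a x : f (a *: x) = a * f x by have := flin a x 0; rewrite f0 !addr0.
have gD x y : g (x + y) = g x + g y by rewrite /g fD raddfD.
have gZ (a : R) x : g (a%:C *: x) = a * g x.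
  by rewrite /g fZ; case: (f x) => b c /=; rewrite mul0r subr0.
pose q x := nrm x ^+ 2 - 2 * g x.
have qge x : - M ^+ 2 <= q x.
  rewrite -subr_ge0 opprK /q.
  have := sqr_ge0 (nrm x - M); have := fM x; rewrite -/(g x); nra.
pose E := [set - q x | x in [set: H]].
have Eub : has_ubound E.
  by exists (M ^+ 2) => _ [x _ <-]; rewrite lerNl.
have Ehs : has_sup E by split=> //; exists (- q 0), 0.
pose m := - sup E.
have mq x : m <= q x by rewrite lerNl; apply: ub_le_sup => //; exists x.
have mx (e : R) : 0 < e -> exists x, q x < m + e.
  move=> e0; have [_ [x _ <-] h] := sup_adherent e0 Ehs.
  by exists x; rewrite /m; lra.
clearbody m.
have par x y : nrm (x - y) ^+ 2 <= 2 * (q x - m) + 2 * (q y - m).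
  have h := mq (2^-1%:C *: (x + y)).
  suff -> : nrm (x - y) ^+ 2 = 2 * q x + 2 * q y - 4 * q (2^-1%:C *: (x + y)) by move: (q _) (q x) (q y) h => a b c; lra.
  rewrite /q -!rdotxx gZ gD !(rdotDl, rdotDr, rdotZl, rdotZr, rdotNl, rdotNr).
  by rewrite (rdotC y x); field.
have /choice[u hu] n : exists x, q x < m + n.+1%:R^-1.
  by apply: mx; rewrite invr_gt0.
have uc : cauchy (u @ \oo).
  apply: cauchy_nrm => e e0.
  have e2 : 0 < e ^+ 2 / 4 by rewrite divr_gt0 // exprn_gt0.
  have [N _ hN] := near_infty_natSinv_lt (PosNum e2).
  exists (u N); exists N => // n /= Nn.
  rewrite -(ltr_pXn2r (n := 2)) ?nnegrE ?nrm_ge0 ?ltW //.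
  apply: le_lt_trans (par _ _) _.
  have h1 : n.+1%:R^-1 < e ^+ 2 / 4 := hN n Nn.
  have h2 : N.+1%:R^-1 < e ^+ 2 / 4 := hN N (leqnn N).
  have := hu N; have := hu n.
  by move: (q _) (q _) (e ^+ 2) (n.+1%:R^-1) (N.+1%:R^-1) h1 h2 => *; lra.
have [z uz] : exists z : H, u x @[x --> \oo] --> z.
  by exists (lim (u x @[x --> \oo])); exact: cauchy_cvg.
have key h : rdot h z = g h.
  have step (t e : R) : 0 < e -> 0 <= t ^+ 2 * nrm h ^+ 2 + 2 * t * (rdot h z - g h) + e.
    move=> e0; have e2 : 0 < e / 2 by rewrite divr_gt0.
    have [N1 _ h1] := near_infty_natSinv_lt (PosNum e2).
    have d0 : 0 < e / 2 / (2 * `|t| * nrm h + 1).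
      rewrite divr_gt0 // ltr_wpDl // !mulr_ge0 // nrm_ge0 //.
    have [N2 _ h2] := (near_nrm_lt _ z).1 uz _ d0.
    pose n := maxn N1 N2.
    have {}h1 : n.+1%:R^-1 < e / 2 := h1 n (leq_maxl _ _).
    have {}h2 : nrm (z - u n) < _ := h2 n (leq_maxr _ _).
    have -> : t ^+ 2 * nrm h ^+ 2 + 2 * t * (rdot h z - g h) =
        q (u n + t%:C *: h) - q (u n) + 2 * (t * rdot h (z - u n)).
      rewrite /q -!rdotxx gD gZ !(rdotDl, rdotDr, rdotZl, rdotZr, rdotNr).
      by rewrite (rdotC _ h); ring.
    have h3 : - (`|t| * (nrm h * nrm (z - u n))) <= t * rdot h (z - u n).
      rewrite lerNl -mulrN; apply: le_trans (ler_norm _) _.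
      rewrite normrM normrN ler_wpM2l // ler_norml rdot_le andbT lerNl.
      by rewrite -rdotNr; apply: le_trans (rdot_le _ _) _; rewrite nrmN.
    have h4 : 2 * (`|t| * (nrm h * nrm (z - u n))) <= e / 2.
      have c0 : 0 <= 2 * `|t| * nrm h by rewrite !mulr_ge0 ?nrm_ge0.
      move: h2; rewrite ltr_pdivlMr; last by rewrite ltr_wpDl.
      have := nrm_ge0 (z - u n).
      move: (nrm (z - u n)) (`|t|) (nrm h) c0 => a b c; nra.
    have := mq (u n + t%:C *: h); have := hu n.
    move: h1 h3 h4; set A := q _; set B := q _; set C := `|t| * _.
    by move: A B C (t * _) (n.+1%:R^-1) => *; lra.
  set D := rdot h z - g h in step *.
  apply/eqP; rewrite -subr_eq0 -/D; apply/negPn/negP => D0.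
  pose N := nrm h ^+ 2 + 1.
  have N0 : 0 < N by rewrite ltr_wpDl // sqr_ge0.
  have DN : 0 < D ^+ 2 / N by rewrite divr_gt0 // exprn_even_gt0.
  have := step (- D / N) (D ^+ 2 / N / 2) (divr_gt0 DN (ltr0n R 2)).
  have -> : nrm h ^+ 2 = N - 1 by rewrite /N addrK.
  suff -> : (- D / N) ^+ 2 * (N - 1) + 2 * (- D / N) * D =
      - (D ^+ 2 / N) - (D / N) ^+ 2.
    have := sqr_ge0 (D / N); move: (_ ^+ 2) (_ / N) DN => a b b0 a0 h1; move: b0; rewrite ltNge => /negP; apply; lra.
  by field; rewrite gt_eqF.
exists z => x; have kx := key x; have := key ('i%C *: x).
rewrite /g fZ /rdot dotZl !Re_imul => /oppr_inj kix.
by move: kx kix; rewrite /rdot /g; case: (f x) (dot x z) => [a b] [c d] /= -> ->.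
Qed.
End HilbertTheory.

(* B(H), for a complex Hilbert space H; its C*-algebra structure needs the
   adjoint, which is obtained from [riesz]. *)
Record bop (R : realType) (H : hilbertType R) := Bop {
  bop_fun :> H -> H;
  bop_linear : linear bop_fun;
  bop_bounded : exists M : R, forall x, nrm (bop_fun x) <= M * nrm x }.

Section BoundedOperators.
Variables (R : realType) (H : hilbertType R).
Implicit Types S T U : bop H.

Lemma bop_ext S T : S =1 T -> S = T.
Proof.
case: S T => [f fl fb] [g gl gb] /= /funext fg; case: _ / fg in gl gb *.
by rewrite (Prop_irrelevance fl gl) (Prop_irrelevance fb gb).
Qed.

Lemma bopD T x y : T (x + y) = T x + T y.
Proof. by have := bop_linear T 1 x y; rewrite !scale1r. Qed.

Lemma bop0 T : T 0 = 0.
Proof. by apply: (addrI (T 0)); rewrite -bopD !addr0. Qed.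

Lemma bopZ T (a : R[i]) x : T (a *: x) = a *: T x.
Proof. by have := bop_linear T a x 0; rewrite bop0 !addr0. Qed.

Definition opnorm T : R := sup [set nrm (T x) | x in [set x | nrm x <= 1]].

Lemma opnorm_le T x : nrm (T x) <= opnorm T * nrm x.
Proof.
have [x0|x0] := eqVneq (nrm x) 0.
  by rewrite x0 (nrm_eq0 x0) bop0 nrm0 mulr0.
have xp : 0 < nrm x by rewrite lt_neqAle eq_sym x0 nrm_ge0.
rewrite -ler_pdivrMr // mulrC.
have -> : (nrm x)^-1 * nrm (T x) = nrm (T ((nrm x)^-1%:C *: x)).
  by rewrite bopZ nrmZr ger0_norm // invr_ge0 nrm_ge0.
apply: ub_le_sup; last first.
  exists ((nrm x)^-1%:C *: x) => //=.
  by rewrite nrmZr ger0_norm ?invr_ge0 ?nrm_ge0 // mulVf.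
have [M TM] := bop_bounded T; exists `|M| => _ [y /= y1 <-].
apply: le_trans (TM y) _; apply: le_trans (ler_norm _) _.
by rewrite normrM (ger0_norm (nrm_ge0 _)) ler_piMr.
Qed.

Lemma opnorm_ge0 T : 0 <= opnorm T.
Proof.
have [[x x0]|h] := pselect (exists x : H, nrm x != 0).
  have xp : 0 < nrm x by rewrite lt_neqAle eq_sym x0 nrm_ge0.
  rewrite -(pmulr_lge0 _ xp); apply: le_trans (opnorm_le T x).
  exact: nrm_ge0.
rewrite le_eqVlt; apply/orP; left; rewrite eq_sym; apply/eqP.
rewrite /opnorm (_ : [set _ | _ in _] = [set 0]) ?sup1 //.
apply/seteqP; split=> [_ [x _ <-]|_ ->] /=.
  by apply/eqP/negPn/negP => Tx; apply: h; exists (T x).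
by exists 0; rewrite ?bop0 /= nrm0.
Qed.

Lemma opnorm_ub T (M : R) : 0 <= M ->
  (forall x, nrm (T x) <= M * nrm x) -> opnorm T <= M.
Proof.
move=> M0 TM; apply: ge_sup; first by exists (nrm (T 0)), 0 => //=; rewrite nrm0.
by move=> _ [x /= x1 <-]; apply: le_trans (TM x) _; rewrite ler_piMr.
Qed.

HB.instance Definition _ := gen_eqMixin (bop H).
HB.instance Definition _ := gen_choiceMixin (bop H).

Program Definition bop_zero := @Bop R H (fun=> 0) _ _.
Next Obligation. by move=> a x y; rewrite scaler0 addr0. Qed.
Next Obligation. by exists 0 => x; rewrite nrm0 mul0r. Qed.

Program Definition bop_opp T := @Bop R H (fun x => - T x) _ _.
Next Obligation. by move=> T a x y; rewrite bop_linear opprD scalerN. Qed.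
Next Obligation. by move=> T; exists (opnorm T) => x; rewrite nrmN opnorm_le. Qed.

Program Definition bop_add S T := @Bop R H (fun x => S x + T x) _ _.
Next Obligation. by move=> S T a x y; rewrite !bop_linear scalerDr addrACA. Qed.
Next Obligation.
move=> S T; exists (opnorm S + opnorm T) => x; apply: le_trans (nrmD _ _) _.
by rewrite mulrDl lerD ?opnorm_le.
Qed.

Program Definition bop_scale (a : R[i]) T := @Bop R H (fun x => a *: T x) _ _.
Next Obligation.
by move=> a T b x y; rewrite bop_linear scalerDr !scalerA mulrC.
Qed.
Next Obligation.
move=> a T; exists (complex.Re `|a| * opnorm T) => x.
by rewrite nrmZ -mulrA ler_wpM2l ?opnorm_le // normc_def sqrtr_ge0.
Qed.

Program Definition bop_one := @Bop R H id _ _.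
Next Obligation. by move=> a x y. Qed.
Next Obligation. by exists 1 => x; rewrite mul1r. Qed.

Program Definition bop_comp S T := @Bop R H (S \o T) _ _.
Next Obligation. by move=> S T a x y; rewrite /= !bop_linear. Qed.
Next Obligation.
move=> S T; exists (opnorm S * opnorm T) => x; apply: le_trans (opnorm_le _ _) _.
by rewrite -mulrA ler_wpM2l ?opnorm_le ?opnorm_ge0.
Qed.

Lemma opnorm_comp S T : opnorm (bop_comp S T) <= opnorm S * opnorm T.
Proof.
apply: opnorm_ub => [|x]; first by rewrite mulr_ge0 ?opnorm_ge0.
apply: le_trans (opnorm_le S (T x)) _.
by rewrite -mulrA ler_wpM2l ?opnorm_le ?opnorm_ge0.
Qed.

Let bop_addA : associative bop_add.
Proof. by move=> S T U; apply: bop_ext => x /=; rewrite addrA. Qed.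
Let bop_addC : commutative bop_add.
Proof. by move=> S T; apply: bop_ext => x /=; rewrite addrC. Qed.
Let bop_add0 : left_id bop_zero bop_add.
Proof. by move=> S; apply: bop_ext => x /=; rewrite add0r. Qed.
Let bop_addN : left_inverse bop_zero bop_opp bop_add.
Proof. by move=> S; apply: bop_ext => x /=; rewrite addNr. Qed.

HB.instance Definition _ := GRing.isZmodule.Build (bop H)
  bop_addA bop_addC bop_add0 bop_addN.

Let bop_scaleA a b T : bop_scale a (bop_scale b T) = bop_scale (a * b) T.
Proof. by apply: bop_ext => x /=; rewrite scalerA. Qed.
Let bop_scale1 : left_id 1 bop_scale.
Proof. by move=> T; apply: bop_ext => x /=; rewrite scale1r. Qed.
Let bop_scaleDr : right_distributive bop_scale +%R.
Proof. by move=> a S T; apply: bop_ext => x /=; rewrite scalerDr. Qed.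
Let bop_scaleDl T : {morph bop_scale^~ T : a b / a + b}.
Proof. by move=> a b; apply: bop_ext => x /=; rewrite scalerDl. Qed.

HB.instance Definition _ := GRing.Zmodule_isLmodule.Build R[i] (bop H)
  bop_scaleA bop_scale1 bop_scaleDr bop_scaleDl.

Let opnormD S T : (opnorm (S + T))%:C <= (opnorm S)%:C + (opnorm T)%:C.
Proof.
rewrite -rmorphD lecR /=; apply: opnorm_ub => [|x].
  by rewrite addr_ge0 ?opnorm_ge0.
by apply: le_trans (nrmD _ _) _; rewrite mulrDl lerD ?opnorm_le.
Qed.

Let opnormZ (a : R[i]) T : (opnorm (a *: T))%:C = `|a| * (opnorm T)%:C.
Proof.
have a0 b : 0 <= complex.Re `|b : R[i]| by rewrite normc_def sqrtr_ge0.
have le b S : opnorm (b *: S) <= complex.Re `|b| * opnorm S.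
  apply: opnorm_ub => [|x]; first by rewrite mulr_ge0 ?opnorm_ge0.
  by rewrite nrmZ -mulrA ler_wpM2l ?opnorm_le.
have -> : `|a| = (complex.Re `|a|)%:C by rewrite normc_def.
rewrite -rmorphM; congr (_%:C); apply/eqP; rewrite eq_le le andTb.
have [->|an0] := eqVneq a 0; first by rewrite normr0 mul0r opnorm_ge0.
have na : 0 < complex.Re `|a|.
  rewrite lt_neqAle a0 andbT eq_sym; apply: contra an0 => /eqP na.
  by rewrite -normr_eq0 normc_def; move: na; rewrite normc_def /= => ->.
rewrite -ler_pdivlMl //; have := le a^-1 (a *: T).
rewrite scalerA mulVf // scale1r normfV.
by rewrite [`|a|]normc_def -(fmorphV (real_complex R)).
Qed.

Let opnorm_eq0 T : (opnorm T)%:C = 0 -> T = 0.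
Proof.
move=> /(congr1 (@complex.Re R)) /= T0; apply: bop_ext => x; apply: nrm_eq0.
by apply/eqP; rewrite eq_le nrm_ge0 andbT; have := opnorm_le T x; rewrite T0 mul0r.
Qed.

HB.instance Definition _ := Lmodule_isNormed.Build R[i] (bop H)
  opnormD opnormZ opnorm_eq0.

Lemma nrm_bop T : nrm T = opnorm T.
Proof. by []. Qed.

Let bop_complete (F : set_system (bop H)) : ProperFilter F -> cauchy F -> cvg F.
Proof.
move=> FF Fc.
have Fx x : cauchy ((fun T => T x) @ F).
  apply: cauchy_nrm => e e0.
  have d0 : 0 < e / (nrm x + 1) by rewrite divr_gt0 // ltr_wpDl // nrm_ge0.
  have [A FA hA] : exists2 A : set (bop H), F A & forall S T, A S -> A T ->
    opnorm (S - T) < e / (nrm x + 1) := cauchy_nrmP FF Fc d0.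
  have [S AS] := filter_ex FA.
  exists (S x); change (F [set T : bop H | nrm (S x - T x) < e]).
  apply: filterS FA => T AT /=.
  have /= h := opnorm_le (S - T) x; apply: le_lt_trans h _.
  have := hA _ _ AS AT; rewrite ltr_pdivlMr; last first.
    by rewrite ltr_wpDl // nrm_ge0.
  by apply: le_lt_trans; rewrite mulrDr mulr1 lerDl opnorm_ge0.
pose f x : H := lim ((fun T : bop H => T x) @ F).
have fP x (e : R) : 0 < e ->
  F [set T : bop H | nrm (f x - T x) < e].
  have : (fun T : bop H => T x) @ F --> f x by exact: cauchy_cvg (Fx x).
  by move/near_nrm_lt => h /h.
have flin : linear f.
  move=> a x y; apply/eqP; rewrite -subr_eq0; apply/eqP/nrm_eq0/eqP.
  rewrite eq_le nrm_ge0 andbT; apply/ler_addgt0Pl => e e0; rewrite addr0.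
  pose c := complex.Re `|a|.
  have c0 : 0 <= c by rewrite /c normc_def sqrtr_ge0.
  have d0 : 0 < e / (2 + c) by rewrite divr_gt0 // ltr_wpDr.
  have [T [[T1 T2] T3]] := filter_ex
    (filterI (filterI (fP (a *: x + y) _ d0) (fP x _ d0)) (fP y _ d0)).
  rewrite (_ : f (a *: x + y) - _ = (f (a *: x + y) - T (a *: x + y)) -
      (a *: (f x - T x) + (f y - T y))); last first.
    by rewrite bop_linear scalerBr addrACA -opprD opprB addrA subrK.
  apply: le_trans (nrmD _ _) _; rewrite nrmN.
  apply: le_trans (lerD (lexx _) (nrmD _ _)) _; rewrite nrmZ -/c.
  apply: le_trans (lerD (ltW T1) (lerD (ler_wpM2l c0 (ltW T2)) (ltW T3))) _.
  rewrite le_eqVlt; apply/orP; left; apply/eqP; field.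
  by rewrite gt_eqF // ltr_wpDr.
have fb (e : R) : 0 < e -> exists2 A, F A &
    forall T x, A T -> nrm (f x - T x) <= e * nrm x.
  move=> e0; have [A FA hA] : exists2 A : set (bop H), F A & forall S T, A S -> A T ->
    opnorm (S - T) < e := cauchy_nrmP FF Fc e0.
  exists A => // T x AT.
  apply/ler_addgt0Pl => d d0.
  have [S [S1 S2]] := filter_ex (filterI (fP x _ d0) FA).
  rewrite -(subrKA (S x)); apply: le_trans (nrmD _ _) _; apply: lerD.
    exact: ltW.
  apply: le_trans (opnorm_le (S - T) x) _; rewrite ler_wpM2r ?nrm_ge0 //.
  exact/ltW/hA.
have fbd : exists M : R, forall x, nrm (f x) <= M * nrm x.
  have [A FA hA] := fb 1 ltr01; have [T AT] := filter_ex FA.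
  exists (1 + opnorm T) => x; rewrite -(subrK (T x) (f x)).
  apply: le_trans (nrmD _ _) _; rewrite mulrDl lerD ?opnorm_le //; exact: hA.
apply/cvg_ex; exists (Bop flin fbd); apply/near_nrm_lt => e e0.
have e2 : 0 < e / 2 by rewrite divr_gt0.
have [A FA hA] := fb _ e2; apply: filterS FA => T AT.
apply: (@le_lt_trans _ _ (e / 2)); last by rewrite gtr_pMr // invf_lt1 ?ltr1n.
by rewrite nrm_bop; apply: opnorm_ub => [|x]; [exact: ltW|exact: hA].
Qed.

HB.instance Definition _ := Uniform_isComplete.Build (bop H) bop_complete.

Let adj_ex T (y : H) : exists z, forall x, dot (T x) y = dot x z.
Proof.
apply: (@riesz _ _ (fun x => dot (T x) y) (opnorm T * nrm y)) => [a x x'|x].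
  by rewrite bop_linear dotDl dotZl.
apply: le_trans (rdot_le _ _) _.
by rewrite mulrAC ler_wpM2r ?nrm_ge0 ?opnorm_le.
Qed.

Definition adj_fun T (y : H) : H := projT1 (cid (adj_ex T y)).

Lemma adj_funP T x y : dot (T x) y = dot x (adj_fun T y).
Proof. exact: projT2 (cid (adj_ex T y)) x. Qed.

Lemma dot_inj (y z : H) : (forall x, dot x y = dot x z) -> y = z.
Proof. by move=> h; apply: dot_ext => x; rewrite /rdot h. Qed.

Let adj_linear T : linear (adj_fun T).
Proof.
move=> a x y; apply: dot_inj => h.
by rewrite -adj_funP !dotDr !dotZr -!adj_funP.
Qed.

Let adj_le T y : nrm (adj_fun T y) <= opnorm T * nrm y.
Proof.
have [->|h] := eqVneq (nrm (adj_fun T y)) 0.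
  by rewrite mulr_ge0 ?nrm_ge0 ?opnorm_ge0.
have hp : 0 < nrm (adj_fun T y) by rewrite lt_neqAle eq_sym h nrm_ge0.
rewrite -(ler_pM2l hp) -expr2 -rdotxx /rdot -adj_funP.
apply: le_trans (rdot_le _ _) _.
by rewrite mulrCA mulrA ler_wpM2r ?nrm_ge0 ?opnorm_le.
Qed.

Definition adj T : bop H :=
  @Bop R H (adj_fun T) (@adj_linear T) (ex_intro _ (opnorm T) (@adj_le T)).

Lemma adjP T x y : dot (T x) y = dot x (adj T y).
Proof. exact: adj_funP. Qed.

Let adjK : involutive adj.
Proof.
by move=> T; apply: bop_ext => x; apply: dot_inj => h; rewrite -adjP dotC -adjP -dotC.
Qed.

Let adjD : {morph adj : S T / S + T}.
Proof.
move=> S T; apply: bop_ext => x; apply: dot_inj => h.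
by rewrite -adjP /= dotDl dotDr -!adj_funP.
Qed.

Let adjZ (a : R[i]) T : adj (a *: T) = a^*%C *: adj T.
Proof.
apply: bop_ext => x; apply: dot_inj => h.
by rewrite -adjP /= dotZl dotZr -!adj_funP conjcK.
Qed.

Let adjM S T : adj (bop_comp S T) = bop_comp (adj T) (adj S).
Proof.
by apply: bop_ext => x; apply: dot_inj => h; rewrite -adjP /= !adj_funP.
Qed.

Let adj_opnorm T : opnorm (bop_comp (adj T) T) = opnorm T ^+ 2.
Proof.
apply/eqP; rewrite eq_le; apply/andP; split.
  apply: le_trans (opnorm_comp _ _) _; rewrite expr2 ler_wpM2r ?opnorm_ge0 //.
  by apply: opnorm_ub => [|x]; [exact: opnorm_ge0|exact: adj_le].
set N := opnorm (bop_comp _ _); have N0 : 0 <= N by exact: opnorm_ge0.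
rewrite -(sqr_sqrtr N0) ler_pXn2r ?nnegrE ?opnorm_ge0 ?sqrtr_ge0 //.
apply: opnorm_ub => [|x]; first exact: sqrtr_ge0.
rewrite -(@ler_pXn2r _ 2) ?nnegrE ?mulr_ge0 ?sqrtr_ge0 ?nrm_ge0 //.
rewrite exprMn sqr_sqrtr // -rdotxx /rdot adjP.
apply: le_trans (rdot_le _ _) _; rewrite mulrC expr2 mulrA.
by rewrite ler_wpM2r ?nrm_ge0 //; exact: (opnorm_le (bop_comp (adj T) T)).
Qed.

Let bop_compA : associative bop_comp.
Proof. by move=> S T U; apply: bop_ext. Qed.
Let bop_comp1l : left_id bop_one bop_comp.
Proof. by move=> T; apply: bop_ext. Qed.
Let bop_comp1r : right_id bop_one bop_comp.
Proof. by move=> T; apply: bop_ext. Qed.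
Let bop_compDl : left_distributive bop_comp +%R.
Proof. by move=> S T U; apply: bop_ext. Qed.
Let bop_compDr : right_distributive bop_comp +%R.
Proof. by move=> S T U; apply: bop_ext => x; rewrite /= bopD. Qed.
Let bop_scaleAl (a : R[i]) S T : a *: bop_comp S T = bop_comp (a *: S) T.
Proof. exact: bop_ext. Qed.
Let bop_scaleAr (a : R[i]) S T : a *: bop_comp S T = bop_comp S (a *: T).
Proof. by apply: bop_ext => x; rewrite /= bopZ. Qed.
Let bop_normM S T : `|bop_comp S T| <= `|S| * `|T|.
Proof. by rewrite !nrmE !nrm_bop -rmorphM lecR opnorm_comp. Qed.
Let bop_cstar T : `|bop_comp (adj T) T| = `|T| ^+ 2.
Proof. by rewrite !nrmE !nrm_bop -rmorphXn adj_opnorm. Qed.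

HB.instance Definition _ := isCstarAlgebra.Build R (bop H)
  bop_compA bop_comp1l bop_comp1r bop_compDl bop_compDr
  bop_scaleAl bop_scaleAr bop_normM adjK adjD adjZ adjM bop_cstar.

HB.instance Definition _ :=
  GRing.PzRing.copy (bop H) (CstarAlgebra.sort (bop H : cstarAlgType R)).

Lemma bop_mulE S T : S * T = bop_comp S T.
Proof. by []. Qed.

Lemma bop_oneE : 1 = bop_one.
Proof. by []. Qed.

End BoundedOperators.

Section GeneratedAlgebras.
Variable R : realType.

Definition closed_star_subalgebra (A : cstarAlgType R) (S : set A) : Prop :=
  [/\ S 1,
      forall x y, S x -> S y -> S (x + y),
      forall (a : R[i]) x, S x -> S (a *: x),
      forall x y, S x -> S y -> S (x * y) &
      forall x, S x -> S (star x)] /\ closed S.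

(* C*(u) *)
Definition cstar_gen (A : cstarAlgType R) d (u : 'I_d -> A) : set A :=
  smallest (@closed_star_subalgebra A) (range u).

(* The restriction of f to S is a unital *-homomorphism. *)
Definition star_hom_on (A B : cstarAlgType R) (S : set A) (f : A -> B) : Prop :=
  [/\ f 1 = 1,
      forall x y, S x -> S y -> f (x + y) = f x + f y,
      forall (a : R[i]) x, S x -> f (a *: x) = a *: f x,
      forall x y, S x -> S y -> f (x * y) = f x * f y &
      forall x, S x -> f (star x) = star (f x)].

(* u ~ v *)
Definition tuple_equiv (A B : cstarAlgType R) d (u : 'I_d -> A) (v : 'I_d -> B) :=
  exists f : A -> B,
    [/\ star_hom_on (cstar_gen u) f,
        set_bij (cstar_gen u) (cstar_gen v) f &
        forall i, f (u i) = v i].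

Definition unitary (A : cstarAlgType R) (x : A) : Prop :=
  star x * x = 1 /\ x * star x = 1.

Definition tuple_norm (A : cstarAlgType R) d (X : 'I_d -> A) : R :=
  \big[Num.max/0]_(i < d) nrm (X i).

(* The infimum is taken in \bar R, where that of the empty set is +oo. *)
Definition d_HR (A B : cstarAlgType R) d (u : 'I_d -> A) (v : 'I_d -> B) : \bar R :=
  ereal_inf [set r : \bar R |
    exists (H : hilbertType R) (u' v' : 'I_d -> bop H),
      [/\ tuple_equiv u' u, tuple_equiv v' v &
          r = (tuple_norm (fun i => u' i - v' i))%:E]].

Definition expi (t : R) : R[i] := (cos t +i* sin t)%C.

Definition unitary_rel d (Theta : 'M[R]_d) (A : cstarAlgType R) (u : 'I_d -> A) :=
  (forall i, unitary (u i)) /\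
  (forall k l, u l * u k = expi (Theta k l) *: (u k * u l)).

(* (A, u) is a model of (A_Theta, u_Theta); the *-homomorphism f below is
   unique, since u generates A. *)
Definition is_universal_rel d (Theta : 'M[R]_d) (A : cstarAlgType R)
    (u : 'I_d -> A) : Prop :=
  [/\ unitary_rel Theta u,
      cstar_gen u = [set: A] &
      forall (B : cstarAlgType R) (v : 'I_d -> B), unitary_rel Theta v ->
        exists f : A -> B, star_hom_on [set: A] f /\ forall i, f (u i) = v i].

Definition l2norm d (x : 'cV[R]_d) : R := Num.sqrt (\sum_i x i 0 ^+ 2).

Definition mx_opnorm d (M : 'M[R]_d) : R :=
  sup [set l2norm (M *m x) | x in [set x : 'cV[R]_d | l2norm x <= 1]].

End GeneratedAlgebras.

(* Main.v *)
Require Import Defs.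
From HB Require Import structures.
From mathcomp Require Import all_boot all_order all_algebra.
From mathcomp Require Import complex ring lra zify.
From mathcomp Require Import all_classical all_reals all_analysis.
Set Implicit Arguments.
Unset Strict Implicit.
Unset Printing Implicit Defensive.
Import Order.TTheory GRing.Theory Num.Theory.
Import numFieldNormedType.Exports.
Local Open Scope classical_set_scope.
Local Open Scope ring_scope.

(* Write Delta = Theta' - Theta and let U, V be the twisted shifts on
   l2(Z^d; M), M an infinite dimensional Hilbert space: U_l sends the fibre over
   g to the fibre over g + e_l with a phase depending on Theta, and V does the
   same with Theta'.  A block diagonal unitary W = (W_g) satisfies
   |U_l - W^* V_l W| <= c as soon as |W_(g + e_l) - chi_l(g) W_g| <= c, where
   chi_l(g) = exp (i (g Delta)_l / 2).

   Isometries J_g with this property come from a product of triangular bumps of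
   width N ~ |Delta|^(-1/2) on Z^d, translated by g with a magnetic phase.  Since
   the bump has mean zero, the variances add up, and only the l2 norms of the
   columns of Delta enter the error eps = O(|Delta|^(1/2)): it does not depend on d.
   The decomposition trick of Pelczynski, applied to J for Delta and to J' for
   - Delta inside a Cuntz algebra, turns them into unitaries at the cost of a
   factor 10.

   Both U and W^* V W are graded by Z^d, hence faithful: the Laurent coefficients
   of p are bounded by the norm of p in the representation, and the n-th power of
   a Laurent polynomial has only polynomially many coefficients, so
   |p^n| <= poly(n) |pi(p)|^n. *)

(** * C*-algebras and *-homomorphisms *)

(** The obstacle is holonomy: around a lattice square the phases chi_l multiply, up to orientation,
    to exp (i Delta_kl), so scalars W_g cannot satisfy W_(g + e_l) = chi_l(g) W_g exactly unless
    these factors are 1. Infinite dimensional fibres leave room to spread this curvature. A bump of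
    width N changes by O(1/N) under a unit translation, while the phase varies over its support by
    O(N |Delta|); balancing the two gives N ~ |Delta|^(-1/2). Unit vectors only give isometries, and
    the way from isometries to unitaries has to respect multiplication by chi_l: one half of the
    swindle is linear in J, the other conjugate linear in J', which is why J' must follow the
    conjugate phases, those of - Delta.

    Faithfulness is needed because the universal property yields only a homomorphism, whereas the
    distance is taken over tuples that generate isomorphic algebras. The growth argument proves it
    with the triangle inequality and the C*-identity alone, without averaging over the torus.

    The constant is 28 = 10 * (14/5), where 14/5 comes from choosing N with 3/2 < N |Delta|^(1/2) <=
    5/2. *)

Section CstarBasics.
Variables (R : realType) (A : cstarAlgType R).
Implicit Types (x y : A) (a : R[i]).

Lemma mulZl a x y : (a *: x) * y = a *: (x * y).
Proof. by rewrite /GRing.mul /= cscaleAl. Qed.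

Lemma mulZr a x y : x * (a *: y) = a *: (x * y).
Proof. by rewrite /GRing.mul /= cscaleAr. Qed.

Lemma nrmM x y : nrm (x * y) <= nrm x * nrm y.
Proof. by rewrite -lecR rmorphM /= -!nrmE; exact: cnormM. Qed.

Lemma starM x y : star (x * y) = star y * star x.
Proof. exact: cstarM. Qed.

Lemma star1 : star 1 = 1 :> A.
Proof. by rewrite -[LHS]mul1r -{1}(starK 1) -starM mul1r starK. Qed.

Lemma star0 : star 0 = 0 :> A.
Proof. by apply: (addrI (star 0)); rewrite -starD !addr0. Qed.

Lemma starN x : star (- x) = - star x.
Proof. by apply: (addrI (star x)); rewrite -starD !subrr star0. Qed.

Lemma starB x y : star (x - y) = star x - star y.
Proof. by rewrite starD starN. Qed.

Lemma nrm_starM x : nrm (star x * x) = nrm x ^+ 2.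
Proof.
have /(congr1 (@complex.Re R)) := cstar_id x.
by rewrite (nrmE x) -rmorphXn.
Qed.

Lemma nrm_star x : nrm (star x) = nrm x.
Proof.
have le y : nrm y <= nrm (star y).
  have [->|y0] := eqVneq (nrm y) 0; first exact: nrm_ge0.
  have yp : 0 < nrm y by rewrite lt_neqAle eq_sym y0 nrm_ge0.
  by rewrite -(ler_pM2r yp) -expr2 -nrm_starM nrmM.
by apply/eqP; rewrite eq_le le -{2}(starK x) le.
Qed.

Lemma nrm1_le : nrm (1 : A) <= 1.
Proof.
have := nrm_starM (1 : A); rewrite star1 mulr1 => h.
have [->//|n0] := eqVneq (nrm (1 : A)) 0.
by rewrite le_eqVlt -(inj_eq (mulfI n0)) -expr2 -h mulr1 eqxx.
Qed.

Lemma nrm_isometry_le x : star x * x = 1 -> nrm x <= 1.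
Proof.
by move=> h; rewrite -(@expr_le1 _ 2) ?nrm_ge0 // -nrm_starM h nrm1_le.
Qed.

Lemma star_exp x n : star x = x -> star (x ^+ n) = x ^+ n.
Proof.
move=> xs; elim: n => [|n IH]; first by rewrite expr0 star1.
by rewrite [in LHS]exprS starM xs IH -exprSr.
Qed.

Lemma nrm_sa_exp x k : star x = x -> nrm (x ^+ (2 ^ k)) = nrm x ^+ (2 ^ k).
Proof.
move=> xs; elim: k => [|k IH]; first by rewrite expn0 !expr1.
by rewrite expnSr !exprM -IH expr2 -{1}(star_exp _ xs) nrm_starM.
Qed.

(** With z = 1 - l, the equation z z = 1 - x x becomes l = (x x + l l) / 2. Its right side is a
    contraction of ratio 1/2 on the ball of radius 1/2, so iteration from 0 converges; all iterates
    are self-adjoint and commute with [x]. *)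
Lemma sa_half_sqrt x : star x = x -> nrm x <= 2^-1 ->
  exists z, [/\ star z = z, z * x = x * z & z * z = 1 - x * x].
Proof.
move=> xs x2.
pose c : R[i] := (2^-1)%:C%C.
pose F w : A := c *: (x * x + w * w).
have cc : c^*%C = c by rewrite /c conjc_real.
have nZ y : nrm (c *: y) = 2^-1 * nrm y by rewrite nrmZr ger0_norm.
pose w n := iter n F (0 : A).
have wS n : w n.+1 = F (w n) by [].
have ws n : star (w n) = w n.
  elim: n => [|n IH]; first exact: star0.
  by rewrite wS /F starZ cc starD !starM xs IH.
have wx n : w n * x = x * w n.
  elim: n => [|n IH]; first by rewrite mul0r mulr0.
  rewrite wS /F mulZl mulZr mulrDl mulrDr !mulrA; congr (_ *: (_ + _)).
  by rewrite -mulrA IH mulrA IH.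
have wn n : nrm (w n) <= 2^-1.
  elim: n => [|n IH]; first by rewrite nrm0 invr_ge0.
  rewrite wS nZ; have := nrmD (x * x) (w n * w n); have := nrmM x x.
  have := nrmM (w n) (w n); have := nrm_ge0 x; have := nrm_ge0 (w n).
  move: IH x2; move: (nrm _) (nrm x) (nrm _) (nrm (x * x)) (nrm _) => *; nra.
have wd n : nrm (w n.+1 - w n) <= 2^-1 ^+ n.
  elim: n => [|n IH].
    by rewrite expr0 subr0 (le_trans (wn 1%N)) // invf_le1 ?ler1n.
  rewrite [w n.+2]wS {2}[w n.+1]wS /F -scalerBr nZ exprS ler_pM2l ?invr_gt0 //.
  rewrite opprD addrACA subrr add0r.
  have -> : w n.+1 * w n.+1 - w n * w n =
      w n.+1 * (w n.+1 - w n) + (w n.+1 - w n) * w n.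
    by rewrite mulrBr mulrBl addrA subrK.
  apply: le_trans (nrmD _ _) _; have := nrmM (w n.+1) (w n.+1 - w n).
  have := nrmM (w n.+1 - w n) (w n); have := nrm_ge0 (w n.+1 - w n).
  move: IH (wn n) (wn n.+1).
  move: (nrm (w n.+1 - w n)) (nrm (w n)) (nrm (w n.+1)) (nrm _) (nrm _) (_ ^+ n) => *; nra.
have wdd n m : nrm (w (n + m)%N - w n) <= 2 * 2^-1 ^+ n - 2 * 2^-1 ^+ (n + m).
  elim: m => [|m IH]; first by rewrite addn0 !subrr nrm0.
  rewrite addnS -(subrKA (w (n + m)%N)); apply: le_trans (nrmD _ _) _.
  by have := wd (n + m)%N; rewrite (exprS _ (n + m)); move: IH; lra.
have wc : cauchy (w @ \oo).
  apply: cauchy_nrm => e e0.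
  have : (2^-1 : R) ^+ n @[n --> \oo] --> (0 : R).
    by apply: cvg_expr; rewrite ger0_norm ?invf_lt1 ?ltr1n.
  move/cvgrPdist_lt => /(_ (e / 2)); rewrite divr_gt0 // => /(_ isT)[N _ hN].
  exists (w N); exists N => // n /= Nn.
  rewrite -(subnKC Nn) nrmB; apply: le_lt_trans (wdd _ _) _.
  have := hN N (leqnn N); rewrite /= sub0r normrN ger0_norm ?exprn_ge0 //.
  have : 0 <= (2^-1 : R) ^+ (N + (n - N)) by rewrite exprn_ge0.
  move: (_ ^+ (_ + _)) (_ ^+ N) => *; lra.
have [l /near_nrm_lt wl] : exists l : A, w n @[n --> \oo] --> l.
  by exists (lim (w n @[n --> \oo])); exact: cauchy_cvg.
have wle (e : R) : 0 < e -> exists n, nrm (l - w n) < e /\ nrm (l - w n.+1) < e.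
  by move=> /wl[N _ hN]; exists N; split; apply: hN => /=.
(* Each identity for the limit holds along the iterates, so its defect at [l] is bounded by the
   distances to two consecutive iterates, and it vanishes. *)
have eq0 y (C : R) : 0 <= C ->
    (forall n, nrm y <= C * nrm (l - w n) + C * nrm (l - w n.+1)) -> y = 0.
  move=> C0 h; apply: nrm_eq0; apply/eqP; rewrite eq_le nrm_ge0 andbT.
  apply/ler_addgt0Pl => e e0; rewrite addr0.
  have C1 : 0 < 2 * C + 1 by rewrite ltr_wpDl // mulr_ge0.
  have /wle[n [h1 h2]] : 0 < e / (2 * C + 1) by rewrite divr_gt0.
  apply: le_trans (h n) _; rewrite -mulrDr.
  move: h1 h2; rewrite !ltr_pdivlMr //.
  have := nrm_ge0 (l - w n); have := nrm_ge0 (l - w n.+1).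
  by move: (nrm _) (nrm _) => *; nra.
have ls : star l = l.
  apply/eqP; rewrite -subr_eq0; apply/eqP/(eq0 _ 2) => // n.
  rewrite -(subrKA (w n)); apply: le_trans (nrmD _ _) _.
  rewrite -{1}(ws n) -starB nrm_star (nrmB (w n)).
  by have := nrm_ge0 (l - w n.+1); move: (nrm _) (nrm _) => *; lra.
have lx : l * x = x * l.
  apply/eqP; rewrite -subr_eq0; apply/eqP/(eq0 _ 1) => // n.
  have -> : l * x - x * l = (l - w n) * x - x * (l - w n).
    by rewrite mulrBl mulrBr wx opprB addrA subrK.
  apply: le_trans (nrmD _ _) _; rewrite nrmN.
  have := nrmM (l - w n) x; have := nrmM x (l - w n); move: x2.
  have := nrm_ge0 (l - w n); have := nrm_ge0 (l - w n.+1); have := nrm_ge0 x.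
  by move: (nrm _) (nrm _) (nrm _) (nrm _) (nrm _) => *; nra.
have lF : l = F l.
  apply/eqP; rewrite -subr_eq0; apply/eqP/(eq0 _ (1 + nrm l)).
    by rewrite addr_ge0 ?nrm_ge0.
  move=> n; have -> : l - F l = (l - w n.+1) - c *: (l * (l - w n) + (l - w n) * w n).
    have -> : l * (l - w n) + (l - w n) * w n = (x * x + l * l) - (x * x + w n * w n).
      rewrite mulrBr mulrBl addrA subrK [in RHS]opprD addrACA subrr add0r //.
    by rewrite scalerBr opprB addrA wS subrK.
  apply: le_trans (nrmD _ _) _; rewrite nrmN nZ.
  have := nrmD (l * (l - w n)) ((l - w n) * w n).
  have := nrmM l (l - w n); have := nrmM (l - w n) (w n); have := wn n.
  have := nrm_ge0 (l - w n); have := nrm_ge0 (l - w n.+1); have := nrm_ge0 l.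
  have := nrm_ge0 (w n).
  move: (nrm (l - w n)) (nrm (l - w n.+1)) (nrm l) (nrm (w n)) (nrm _) (nrm _) (nrm _).
  move=> *; nra.
exists (1 - l); split; first by rewrite starB star1 ls.
  by rewrite mulrBl mulrBr mul1r mulr1 lx.
have : 2%:R *: l = x * x + l * l.
  rewrite {1}lF /F scalerA (_ : 2%:R * c = 1) ?scale1r // /c.
  by rewrite -[2%:R](rmorph_nat (real_complex R)) -rmorphM divff.
rewrite scaler_nat mulr2n => e.
have -> : x * x = l + l - l * l by rewrite e addrK.
rewrite mulrBr mulr1 mulrBl mul1r opprB -addrA; congr (_ + _).
by rewrite opprB opprD addrCA.
Qed.

End CstarBasics.

Lemma bernoulli_le (R : realFieldType) (x : R) n :
  0 <= x -> 1 + n%:R * x <= (1 + x) ^+ n.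
Proof.
move=> x0; elim: n => [|n IH]; first by rewrite mul0r addr0 expr0.
rewrite exprS -natr1; apply: le_trans (ler_wpM2l _ IH); last by rewrite addr_ge0.
have := mulr_ge0 (ler0n R n) (mulr_ge0 x0 x0); move: (n%:R) => *; nra.
Qed.

(* A polynomial factor is invisible after taking [2 ^ k]-th roots. *)
Lemma le_of_le_exp2n (R : realType) (a b C : R) D : 0 <= b -> 0 <= C ->
  (forall k, a ^+ (2 ^ k) <= (C * 2 ^+ k) ^+ D * b ^+ (2 ^ k)) -> a <= b.
Proof.
move=> b0 C0 h; rewrite leNgt; apply/negP => ba.
have a0 : 0 < a by apply: le_lt_trans ba.
have [bz|bn] := eqVneq b 0.
  have := h 0%N; by rewrite bz expn0 !expr1 mulr0 leNgt a0.
have bp : 0 < b by rewrite lt_neqAle eq_sym bn.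
pose r := a / b - 1.
have r0 : 0 < r by rewrite subr_gt0 ltr_pdivlMr ?mul1r.
have {}h k : (1 + r) ^+ (2 ^ k) <= (C * 2 ^+ k) ^+ D.
  by rewrite /r addrC subrK expr_div_n ler_pdivrMr ?exprn_gt0.
(* The hypothesis is used at D + k. Since 2 ^ D >= D + 1, Bernoulli gives the lower bound (2 ^ k r)
   ^ (D + 1), one degree above the upper bound (C 2 ^ (D + k)) ^ D; this forces 2 ^ k <= E, against
   the choice of [k]. *)
pose E := (C * 2 ^+ D) ^+ D / r ^+ D.+1.
pose k := Num.bound E.
have : E < 2 ^+ k.
  apply: lt_le_trans (archi_boundP _) _.
    by rewrite divr_ge0 ?exprn_ge0 ?mulr_ge0 ?exprn_ge0 // ltW.
  by rewrite -natrX ler_nat ltnW // ltn_expl.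
apply/negP; rewrite -leNgt /E ler_pdivlMr ?exprn_gt0 //.
have k0 : 0 < (2 : R) ^+ k by rewrite exprn_gt0.
rewrite -(@ler_pM2r _ ((2 ^+ k) ^+ D)) ?exprn_gt0 //.
rewrite (_ : (C * 2 ^+ D) ^+ D * (2 ^+ k) ^+ D = (C * 2 ^+ (D + k)) ^+ D); last first.
  by rewrite -exprMn exprD mulrA.
rewrite (_ : 2 ^+ k * r ^+ D.+1 * (2 ^+ k) ^+ D = (2 ^+ k * r) ^+ D.+1); last first.
  by rewrite exprMn [in RHS]exprS; ring.
apply: le_trans (h (D + k)%N).
rewrite expnD mulnC exprM.
have h1 : 2 ^+ k * r <= (1 + r) ^+ (2 ^ k).
  by apply: le_trans (bernoulli_le _ (ltW r0)); rewrite natrX lerDr.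
have h2 : 1 <= (1 + r) ^+ (2 ^ k) by rewrite exprn_ege1 // lerDl ltW.
apply: (@le_trans _ _ (((1 + r) ^+ (2 ^ k)) ^+ D.+1)).
  have r1 : 0 <= 1 + r by rewrite addr_ge0 // ltW.
  by apply: lerXn2r; rewrite ?nnegrE ?exprn_ge0 ?mulr_ge0 // ltW.
by rewrite ler_weXn2l // ltn_expl.
Qed.

Section StarHom.
Variables (R : realType) (A B : cstarAlgType R) (f : A -> B).
Hypothesis fhom : star_hom_on [set: A] f.

Lemma star_hom1 : f 1 = 1. Proof. by case: fhom. Qed.
Lemma star_homD x y : f (x + y) = f x + f y. Proof. by case: fhom => _ h _ _ _; exact: h. Qed.
Lemma star_homZ (a : R[i]) x : f (a *: x) = a *: f x. Proof. by case: fhom => _ _ h _ _; exact: h. Qed.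
Lemma star_homM x y : f (x * y) = f x * f y. Proof. by case: fhom => _ _ _ h _; exact: h. Qed.
Lemma star_hom_star x : f (star x) = star (f x). Proof. by case: fhom => _ _ _ _ h; exact: h. Qed.

Lemma star_hom0 : f 0 = 0.
Proof. by apply: (addrI (f 0)); rewrite -star_homD !addr0. Qed.

Lemma star_homN x : f (- x) = - f x.
Proof. by apply: (addrI (f x)); rewrite -star_homD !subrr star_hom0. Qed.

Lemma star_homB x y : f (x - y) = f x - f y.
Proof. by rewrite star_homD star_homN. Qed.

Lemma star_homX x n : f (x ^+ n) = f x ^+ n.
Proof. by elim: n => [|n IH]; rewrite ?expr0 ?star_hom1 // !exprS star_homM IH. Qed.

Lemma star_hom_sum (I : finType) (F : I -> A) : f (\sum_i F i) = \sum_i f (F i).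
Proof. exact: (big_morph _ star_homD star_hom0). Qed.

(* [x] is the real part of the unitary [x + i sqrt (1 - x ^ 2)]. *)
Lemma star_hom_half x : star x = x -> nrm x <= 2^-1 -> nrm (f x) <= 1.
Proof.
move=> xs /(sa_half_sqrt xs)[z [zs zx zz]].
have as' : star (f x) = f x by rewrite -star_hom_star xs.
have bs : star (f z) = f z by rewrite -star_hom_star zs.
have ba : f z * f x = f x * f z by rewrite -!star_homM zx.
have bb : f z * f z = 1 - f x * f x by rewrite -!star_homM zz star_homB star_hom1.
move: (f x) (f z) as' bs ba bb => a b as' bs ba bb.
pose V : B := a + 'i%C *: b.
have Vs : star V = a - 'i%C *: b.
  rewrite starD starZ as' bs; congr (_ + _).
  by rewrite (_ : ('i%C)^*%C = - 'i%C) ?scaleNr //; apply/eqP; rewrite eq_complex /= oppr0 !eqxx.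
have ii : 'i%C * 'i%C = -1 :> R[i] by rewrite -expr2 sqr_i.
have VV : star V * V = 1.
  rewrite Vs /V mulrBl !mulrDr !mulZl !mulZr ba scalerA ii scaleN1r bb opprD.
  by rewrite opprK addrA addrK addrC subrK.
have aE : (2%:R : R[i]) *: a = V + star V by rewrite Vs /V addrACA subrr addr0 scaler_nat mulr2n.
have : nrm ((2%:R : R[i]) *: a) <= 2.
  rewrite aE; apply: le_trans (nrmD _ _) _; rewrite nrm_star.
  by have := nrm_isometry_le VV; lra.
rewrite -(rmorph_nat (real_complex R)) nrmZr ger0_norm //; lra.
Qed.

(** Scaling [star_hom_half] gives the bound with a factor 2 on self-adjoint elements. Applied to
    their powers 2 ^ k, where the norm is multiplicative, the factor disappears; the general case
    follows from the C*-identity. *)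
Lemma star_hom_contraction x : nrm (f x) <= nrm x.
Proof.
have sa2 y : star y = y -> nrm (f y) <= 2 * nrm y.
  move=> ys; have [y0|y0] := eqVneq (nrm y) 0.
    by rewrite (nrm_eq0 y0) star_hom0 !nrm0 mulr0.
  have yp : 0 < nrm y by rewrite lt_neqAle eq_sym y0 nrm_ge0.
  have t0 : 0 <= (2 * nrm y)^-1 by rewrite invr_ge0 mulr_ge0 ?nrm_ge0.
  have := @star_hom_half ((2 * nrm y)^-1%:C%C *: y).
  rewrite starZ conjc_real ys star_homZ !nrmZr (ger0_norm t0).
  move=> h; have {h} : (2 * nrm y)^-1 * nrm (f y) <= 1.
    by apply: h => //; rewrite invfM mulfVK.
  by rewrite mulrC ler_pdivrMr ?mulr_gt0 // mul1r.
have sa y : star y = y -> nrm (f y) <= nrm y.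
  move=> ys; apply: (@le_of_le_exp2n _ _ _ 2 1); rewrite ?nrm_ge0 // => k.
  rewrite -nrm_sa_exp -?star_hom_star ?ys // -star_homX.
  apply: le_trans (sa2 _ (star_exp _ ys)) _; rewrite nrm_sa_exp // expr1.
  by rewrite ler_wpM2r ?exprn_ge0 ?nrm_ge0 // ler_peMr // exprn_ege1 // ler1n.
rewrite -(@ler_pXn2r _ 2) ?nnegrE ?nrm_ge0 // -!nrm_starM -star_hom_star -star_homM.
by apply: sa; rewrite starM starK.
Qed.

End StarHom.

(** * Laurent polynomials in phase-commuting unitaries *)

Section PhaseCommutation.
Variables (R : realType) (A : cstarAlgType R).
Implicit Types x y z : A.

(** Equality up to a unimodular scalar. Only moduli of coefficients enter the norm estimates, so the
    cocycle of the commutation relations is never computed. *)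
Definition peq x y := exists2 c : R[i], `|c| = 1 & x = c *: y.

Lemma peq_refl x : peq x x.
Proof. by exists 1; rewrite ?normr1 ?scale1r. Qed.

Lemma peq_sym x y : peq x y -> peq y x.
Proof.
move=> [c c1 ->]; exists c^-1; first by rewrite normfV c1 invr1.
by rewrite scalerA mulVf ?scale1r // -normr_gt0 c1.
Qed.

Lemma peq_trans y x z : peq x y -> peq y z -> peq x z.
Proof.
by move=> [c c1 ->] [e e1 ->]; exists (c * e); rewrite ?scalerA // normrM c1 e1 mulr1.
Qed.

Lemma peqM x x' y y' : peq x x' -> peq y y' -> peq (x * y) (x' * y').
Proof.
move=> [c c1 ->] [e e1 ->]; exists (c * e); first by rewrite normrM c1 e1 mulr1.
by rewrite mulZl mulZr scalerA.
Qed.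

Definition pcomm x y := peq (x * y) (y * x).

Lemma pcomm_sym x y : pcomm x y -> pcomm y x.
Proof. exact: peq_sym. Qed.

Lemma pcommM x y z : pcomm x y -> pcomm x z -> pcomm x (y * z).
Proof.
move=> xy xz; rewrite /pcomm mulrA -mulrA.
apply: (@peq_trans (y * x * z)); first by rewrite mulrA; apply: peqM xy (peq_refl z).
by rewrite -!mulrA; apply: peqM (peq_refl y) xz.
Qed.

Lemma pcommX x y n : pcomm x y -> pcomm x (y ^+ n).
Proof.
move=> xy; elim: n => [|n IH]; first by rewrite expr0 /pcomm mulr1 mul1r; exact: peq_refl.
by rewrite exprS; exact: pcommM.
Qed.

Lemma pcomm_starr x y : unitary y -> pcomm x y -> pcomm x (star y).
Proof.
move=> [y1 y2] xy; apply: pcomm_sym.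
have := peqM (peqM (peq_refl (star y)) xy) (peq_refl (star y)).
by rewrite mulrA -[_ * y * _]mulrA y2 mulr1 [star y * (y * x)]mulrA y1 mul1r.
Qed.

Lemma unitary_star x : unitary x -> unitary (star x).
Proof. by case=> h1 h2; split; rewrite starK. Qed.

Lemma unitaryM x y : unitary x -> unitary y -> unitary (x * y).
Proof.
move=> [x1 x2] [y1 y2]; split; rewrite starM mulrA.
  by rewrite -(mulrA (star y)) x1 mulr1.
by rewrite -(mulrA x) y2 mulr1.
Qed.

Lemma unitary1 : unitary (1 : A).
Proof. by split; rewrite star1 mulr1. Qed.

Lemma unitaryX x n : unitary x -> unitary (x ^+ n).
Proof.
by move=> xu; elim: n => [|n IH]; [rewrite expr0; exact: unitary1|rewrite exprS; exact: unitaryM].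
Qed.

Definition upow x (z : int) : A :=
  match z with Posz n => x ^+ n | Negz n => star x ^+ n.+1 end.

Lemma upow_unitary x (z : int) : unitary x -> unitary (upow x z).
Proof. by case: z => n xu /=; apply: unitaryX => //; exact: unitary_star. Qed.

Lemma upowS x (z : int) : unitary x -> x * upow x z = upow x (z + 1).
Proof.
move=> [x1 x2]; case: z => [n|[|n]].
- by rewrite (_ : Posz n + 1 = Posz n.+1) ?[in RHS]/upow ?exprS //; lia.
- by rewrite (_ : Negz 0 + 1 = Posz 0) //= expr1 x2.
- rewrite (_ : Negz n.+1 + 1 = Negz n) /=; first by rewrite exprS mulrA x2 mul1r.
  by rewrite !NegzE; lia.
Qed.

Lemma upowP x (z : int) : unitary x -> star x * upow x z = upow x (z - 1).
Proof.
move=> xu; rewrite -{1}(subrK 1 z) -upowS // mulrA.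
by case: xu => -> _; rewrite mul1r.
Qed.

Lemma pcomm_upow x y (z : int) : unitary y -> pcomm x y -> pcomm x (upow y z).
Proof. by move=> yu xy; case: z => n; apply: pcommX => //; exact: pcomm_starr. Qed.

End PhaseCommutation.

Section Monomials.
Variables (R : realType) (A : cstarAlgType R) (d : nat) (u : 'I_d -> A).
Hypotheses (uu : forall i, unitary (u i)) (uc : forall i j, pcomm (u i) (u j)).
Implicit Types (g h : 'rV[int]_d) (x y : A).

Definition umono g : A := \prod_(i < d) upow (u i) (g 0 i).

Lemma umono_unitary g : unitary (umono g).
Proof.
apply: (big_ind (@unitary _ A)); [exact: unitary1|exact: unitaryM|].
by move=> i _; exact: upow_unitary.
Qed.

Lemma umono0 : umono 0 = 1.
Proof. by rewrite /umono big1 // => i _; rewrite mxE. Qed.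

(** Common core of [umonoS] and [umonoP]: [x] is moved past the factors that precede the [i]-th one,
    at the cost of a phase each, and is absorbed there. *)
Let insert x (P Q : 'I_d -> A) i s :
  (forall j, pcomm x (P j)) -> (forall j, j != i -> Q j = P j) ->
  x * P i = Q i -> i \in s -> uniq s ->
  peq (x * \prod_(j <- s) P j) (\prod_(j <- s) Q j).
Proof.
move=> xP QP xi; elim: s => // j s IH; rewrite inE => /orP[/eqP<-|js] /= /andP[ns us].
  rewrite !big_cons mulrA xi (_ : \prod_(k <- s) Q k = \prod_(k <- s) P k).
    exact: peq_refl.
  rewrite !big_seq; apply: eq_bigr => k ks; apply: QP.
  by apply: contraNneq ns => <-.
have ji : j != i by apply: contraNneq ns => ->.
rewrite !big_cons mulrA QP //; apply: peq_trans (peqM (xP j) (peq_refl _)) _.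
by rewrite -mulrA; apply: peqM (peq_refl _) (IH js us).
Qed.

Lemma umonoS g i : peq (u i * umono g) (umono (g + delta_mx 0 i)).
Proof.
apply: (@insert _ _ _ i); rewrite ?mem_index_enum ?index_enum_uniq //.
- by move=> j; exact: pcomm_upow.
- by move=> j ji; rewrite !mxE eqxx (negbTE ji) addr0.
- by rewrite upowS // !mxE !eqxx.
Qed.

Lemma umonoP g i : peq (star (u i) * umono g) (umono (g - delta_mx 0 i)).
Proof.
apply: (@insert _ _ _ i); rewrite ?mem_index_enum ?index_enum_uniq //.
- by move=> j; apply: pcomm_upow => //; apply/pcomm_sym/pcomm_starr.
- by move=> j ji; rewrite !mxE eqxx (negbTE ji) subr0.
- by rewrite upowP // !mxE !eqxx.
Qed.

Lemma upow_umono g i z : peq (upow (u i) z * umono g) (umono (g + z *: delta_mx 0 i)).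
Proof.
case: z => n /=.
  elim: n => [|n IH]; first by rewrite expr0 mul1r scale0r addr0; exact: peq_refl.
  rewrite exprS -mulrA; apply: peq_trans (peqM (peq_refl _) IH) _.
  rewrite (_ : Posz n.+1 = Posz n + 1) ?scalerDl ?scale1r ?addrA; last by lia.
  exact: umonoS.
elim: n => [|n IH].
  by rewrite expr1 (_ : Negz 0 = -1) // scaleN1r; exact: umonoP.
rewrite exprS -mulrA; apply: peq_trans (peqM (peq_refl _) IH) _.
rewrite (_ : Negz n.+1 = Negz n - 1) ?scalerBl ?scale1r ?addrA; first exact: umonoP.
by rewrite !NegzE; lia.
Qed.

Lemma umonoM g h : peq (umono g * umono h) (umono (g + h)).
Proof.
have -> : g + h = h + \sum_(i < d) g 0 i *: delta_mx 0 i.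
  by rewrite addrC {1}(row_sum_delta g).
rewrite {1}/umono; elim: (index_enum _) h => [|i s IH] h.
  by rewrite !big_nil mul1r addr0; exact: peq_refl.
rewrite !big_cons -mulrA; apply: peq_trans (peqM (peq_refl _) (IH h)) _.
rewrite [_ *: _ + _]addrC addrA.
exact: upow_umono.
Qed.

Lemma umono_star g : peq (star (umono g)) (umono (- g)).
Proof.
have [m1 m2] := umono_unitary g.
have := umonoM (- g) g; rewrite addNr umono0 => /peqM/(_ (peq_refl (star (umono g)))).
by rewrite -mulrA m2 mulr1 mul1r => /peq_sym.
Qed.

Definition boxed m g := forall i, (`|g 0%R i| <= m)%N.

Definition box_row m (t : {ffun 'I_d -> 'I_m.*2.+1}) : 'rV[int]_d :=
  \row_i ((t i)%:Z - m%:Z).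

Lemma boxedP m g : boxed m g -> exists t : {ffun 'I_d -> 'I_m.*2.+1}, g = box_row t.
Proof.
move=> gm; exists [ffun i => inord `|(g 0%R i + m%:Z)%R|%N].
by apply/rowP => i; rewrite mxE ffunE inordK; have := gm i; lia.
Qed.

Lemma box_boxed m (t : {ffun 'I_d -> 'I_m.*2.+1}) : boxed m (box_row t).
Proof. by move=> i; rewrite mxE; have := ltn_ord (t i); lia. Qed.

Lemma box_row_inj m : injective (@box_row m).
Proof.
move=> s t /rowP st; apply/ffunP => i; apply/val_inj.
by have := st i; rewrite !mxE /=; lia.
Qed.

(** The degree is bounded in each variable separately: the exponents then form a finite type with (2
    m + 1) ^ d elements, and this number is the polynomial factor of the growth argument. *)
Definition laurent m x :=
  exists c : {ffun 'I_d -> 'I_m.*2.+1} -> R[i], x = \sum_t c t *: umono (box_row t).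

Lemma laurent_mono m g : boxed m g -> laurent m (umono g).
Proof.
move=> /boxedP[t ->]; exists (fun s => (s == t)%:R).
by rewrite (bigD1 t) //= eqxx scale1r big1 ?addr0 // => s /negbTE->; rewrite scale0r.
Qed.

Lemma laurentD m x y : laurent m x -> laurent m y -> laurent m (x + y).
Proof.
move=> [c ->] [e ->]; exists (fun t => c t + e t).
by rewrite -big_split /=; apply: eq_bigr => t _; rewrite scalerDl.
Qed.

Lemma laurentZ m (a : R[i]) x : laurent m x -> laurent m (a *: x).
Proof.
move=> [c ->]; exists (fun t => a * c t).
by rewrite scaler_sumr; apply: eq_bigr => t _; rewrite scalerA.
Qed.

Lemma laurent_peq m x y : peq x y -> laurent m y -> laurent m x.
Proof. by move=> [c _ ->]; exact: laurentZ. Qed.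

Lemma laurent_sum m (I : finType) (F : I -> A) :
  (forall i, laurent m (F i)) -> laurent m (\sum_i F i).
Proof.
move=> Fm; apply: (big_ind (laurent m)) => //; last exact: laurentD.
by exists (fun=> 0); rewrite big1 // => t _; rewrite scale0r.
Qed.

Lemma laurentW m n x : (m <= n)%N -> laurent m x -> laurent n x.
Proof.
move=> mn [c ->]; apply: laurent_sum => t; apply/laurentZ/laurent_mono => i.
exact: leq_trans (box_boxed t i) mn.
Qed.

Lemma laurentM m n x y : laurent m x -> laurent n y -> laurent (m + n) (x * y).
Proof.
move=> [c ->] [e ->]; rewrite mulr_suml; apply: laurent_sum => s.
rewrite mulr_sumr; apply: laurent_sum => t.
rewrite mulZl mulZr; apply/laurentZ/laurentZ/(laurent_peq (umonoM _ _))/laurent_mono.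
by move=> i; have := box_boxed s i; have := box_boxed t i; rewrite !mxE; lia.
Qed.

Lemma laurent_star m x : laurent m x -> laurent m (star x).
Proof.
move=> [c ->]; rewrite (big_morph _ (@starD _ A) (star0 A)); apply: laurent_sum => t.
rewrite starZ; apply/laurentZ/(laurent_peq (umono_star _))/laurent_mono.
by move=> i; have := box_boxed t i; rewrite !mxE; lia.
Qed.

Lemma laurent1 m : laurent m 1.
Proof. by rewrite -umono0; apply: laurent_mono => i; rewrite mxE. Qed.

Lemma laurentX m n x : laurent m x -> laurent (m * n) (x ^+ n).
Proof.
move=> xm; elim: n => [|n IH]; first by rewrite expr0; exact: laurent1.
by rewrite exprS mulnS; exact: laurentM.
Qed.

Lemma laurent_gen i : laurent 1 (u i).
Proof.
have := umonoS 0 i; rewrite umono0 mulr1 add0r => /laurent_peq; apply.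
by apply: laurent_mono => j; rewrite mxE; case: eqP => //; case: eqP.
Qed.

Lemma closed_nrmP (S : set A) :
  closed S <-> forall x, (forall e : R, 0 < e -> exists2 y, S y & nrm (x - y) < e) -> S x.
Proof.
split=> [cS x h|h x Sx].
  apply: cS => B /nbhs_ballP[[e f]] /=; rewrite ltcE /= => /andP[/eqP-> e0] xB.
  have [y Sy xy] := h e e0; exists y; split=> //; apply: xB.
  by rewrite -ball_normE /ball_ /= nrmE ltcR.
apply: h => e e0; have [|y [Sy]] := Sx (ball x e%:C%C).
  by apply: nbhsx_ballx; rewrite ltcR.
by rewrite -ball_normE /ball_ /= nrmE ltcR => xy; exists y.
Qed.

(** The norm closure of the Laurent polynomials is a closed star subalgebra that contains the
    generators, hence everything they generate. *)
Lemma laurent_dense : cstar_gen u = [set: A] -> forall x (e : R), 0 < e ->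
  exists m y, laurent m y /\ nrm (x - y) < e.
Proof.
move=> ug.
pose S := [set x : A | forall e : R, 0 < e -> exists m y, laurent m y /\ nrm (x - y) < e].
suff cS : closed_star_subalgebra S.
  move=> x; have : cstar_gen u x by rewrite ug.
  move=> /(_ S) h; apply: h; split=> // _ [i _ <-] e e0; exists 1%N, (u i).
  by split; [exact: laurent_gen|rewrite subrr nrm0].
have lS m y : laurent m y -> S y.
  by move=> my e e0; exists m, y; rewrite subrr nrm0.
split; last first.
  apply/closed_nrmP => x h e e0; have e2 : 0 < e / 2 by rewrite divr_gt0.
  have [y /(_ _ e2)[m [z [mz yz]]] xy] := h _ e2.
  exists m, z; split=> //; rewrite -(subrKA y) (splitr e).
  by apply: le_lt_trans (nrmD _ _) _; rewrite ltrD.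
split=> [|x y Sx Sy e e0|a x Sx e e0|x y Sx Sy e e0|x Sx e e0].
- exact: lS (laurent1 0).
- have e2 : 0 < e / 2 by rewrite divr_gt0.
  have [[m [x' [mx xx]]] [n [y' [ny yy]]]] := (Sx _ e2, Sy _ e2).
  exists (m + n)%N, (x' + y'); split.
    by apply: laurentD; [apply: laurentW mx|apply: laurentW ny]; lia.
  rewrite opprD addrACA (splitr e).
  by apply: le_lt_trans (nrmD _ _) _; rewrite ltrD.
- have a0 : 0 <= complex.Re `|a| by rewrite normc_def sqrtr_ge0.
  have a1 : 0 < complex.Re `|a| + 1 by rewrite ltr_wpDl.
  have [|m [y [my xy]]] := Sx (e / (complex.Re `|a| + 1)); first by rewrite divr_gt0.
  exists m, (a *: y); split; first exact: laurentZ.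
  rewrite -scalerBr nrmZ; move: xy; rewrite ltr_pdivlMr //.
  by have := nrm_ge0 (x - y); move: a0 (nrm _); clear; move=> *; nra.
(* The minimum with 1 keeps the norm of [x'] below nrm x + 1, so that the tolerance for [y] can be
   fixed beforehand. *)
- have [|m [x' [mx xx]]] := Sx (Num.min 1 (e / 2 / (nrm y + 1))).
    by rewrite lt_min ltr01 !divr_gt0 // ltr_wpDl ?nrm_ge0.
  have [|n [y' [ny yy]]] := Sy (e / 2 / (nrm x + 1)).
    by rewrite !divr_gt0 // ltr_wpDl ?nrm_ge0.
  move: xx yy; rewrite lt_min => /andP[x1]; rewrite !ltr_pdivlMr ?ltr_wpDl ?nrm_ge0 //.
  move=> xx yy; exists (m + n)%N, (x' * y'); split; first exact: laurentM.
  have -> : x * y - x' * y' = (x - x') * y + x' * (y - y').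
    by rewrite mulrBl mulrBr addrA subrK.
  apply: le_lt_trans (nrmD _ _) _.
  have := nrmM (x - x') y; have := nrmM x' (y - y').
  have : nrm x' <= nrm x + 1.
    rewrite -(subrK x x'); apply: le_trans (nrmD _ _) _.
    by rewrite nrmB addrC lerD2l ltW.
  have := nrm_ge0 (x - x'); have := nrm_ge0 (y - y'); have := nrm_ge0 y.
  have := nrm_ge0 x'; move: xx yy {x1}.
  move: (nrm (x - x')) (nrm (y - y')) (nrm x) (nrm y) (nrm x') (nrm _) (nrm _).
  move=> *; nra.
- have [m [y [my xy]]] := Sx e e0; exists m, (star y); split; first exact: laurent_star.
  by rewrite -starB nrm_star.
Qed.

End Monomials.

(** * Faithfulness of graded representations *)

Section HilbertExtras.
Variables (R : realType) (H : hilbertType R).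
Implicit Types (x y : H) (S T : bop H).

Lemma pythagoras x y : dot x y = 0 -> nrm (x + y) ^+ 2 = nrm x ^+ 2 + nrm y ^+ 2.
Proof.
move=> xy; rewrite -!rdotxx rdotDl !rdotDr (rdotC y x) {2 3}/rdot xy /=.
by rewrite addr0 add0r.
Qed.

Lemma bop_sumE (I : Type) (s : seq I) (P : pred I) (F : I -> bop H) x :
  (\sum_(i <- s | P i) F i) x = \sum_(i <- s | P i) F i x.
Proof. exact: (big_morph (fun T : bop H => T x) (fun S T => erefl) erefl). Qed.

Lemma dot_sumr (I : Type) (s : seq I) (P : pred I) (F : I -> H) x :
  dot x (\sum_(i <- s | P i) F i) = \sum_(i <- s | P i) dot x (F i).
Proof.
apply: (big_morph (dot x)) => [y z|]; first exact: dotDr.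
by rewrite dotC dot0l conjc0.
Qed.

Lemma dot_star T x y : dot (T x) y = dot x (star T y).
Proof. exact: adjP. Qed.

Lemma isometry_nrm T x : star T * T = 1 -> nrm (T x) = nrm x.
Proof.
move=> TT; apply/eqP; rewrite -(@eqrXn2 _ 2) ?nrm_ge0 // -!rdotxx /rdot dot_star.
by rewrite -[star T (T x)]/((star T * T) x) TT.
Qed.

End HilbertExtras.

Section Faithful.
Variables (R : realType) (A : cstarAlgType R) (d : nat) (u : 'I_d -> A).
Hypotheses (uu : forall i, unitary (u i)) (uc : forall i j, pcomm (u i) (u j)).
Hypothesis ug : cstar_gen u = [set: A].
Variables (H : hilbertType R) (f : A -> bop H).
Hypothesis fhom : star_hom_on [set: A] f.
(** [G g] holds the vectors of degree [g]; the generators raise the degree by a basis vector, their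
    adjoints lower it, and [xi] is a unit vector of degree 0. *)
Variables (G : 'rV[int]_d -> set H) (xi : H).
Hypothesis Gorth : forall g h x y, g != h -> G g x -> G h y -> dot x y = 0.
Hypothesis GU : forall i g x, G g x -> G (g + delta_mx 0 i) (f (u i) x).
Hypothesis GV : forall i g x, G g x -> G (g - delta_mx 0 i) (star (f (u i)) x).
Hypotheses (Gxi : G 0 xi) (xi1 : nrm xi = 1).

Let f_upow x z : f (upow x z) = upow (f x) z.
Proof. by case: z => n /=; rewrite (star_homX fhom) ?(star_hom_star fhom). Qed.

Let GX i z g x : G g x -> G (g + z *: delta_mx 0 i) (f (upow (u i) z) x).
Proof.
rewrite f_upow => Gx; case: z => n /=.
  elim: n => [|n IH]; first by rewrite expr0 scale0r addr0.
  rewrite exprS (_ : Posz n.+1 = Posz n + 1) ?scalerDl ?scale1r ?addrA; last by lia.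
  exact: GU.
elim: n => [|n IH]; first by rewrite expr1 (_ : Negz 0 = -1) // scaleN1r; exact: GV.
rewrite exprS (_ : Negz n.+1 = Negz n - 1) ?scalerBl ?scale1r ?addrA; first exact: GV.
by rewrite !NegzE; lia.
Qed.

Let Gmono g : G g (f (umono u g) xi).
Proof.
rewrite {1}(row_sum_delta g) /umono; elim: (index_enum _) => [|i s IH].
  by rewrite !big_nil (star_hom1 fhom).
by rewrite !big_cons (star_homM fhom) addrC; exact: GX.
Qed.

Let nrm_mono g : nrm (f (umono u g) xi) = 1.
Proof.
rewrite isometry_nrm // -(star_hom_star fhom) -(star_homM fhom).
by have [-> _] := umono_unitary uu g; rewrite (star_hom1 fhom).
Qed.

(** The images of [xi] under distinct monomials have distinct degrees, so they are orthonormal, and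
    each coefficient is seen in the norm of the image of [xi]. *)
Let coef_le m (c : {ffun 'I_d -> 'I_m.*2.+1} -> R[i]) s :
  complex.Re `|c s| <= nrm (f (\sum_t c t *: umono u (box_row t))).
Proof.
set x := \sum_t _.
have c0 : 0 <= complex.Re `|c s| by rewrite normc_def sqrtr_ge0.
apply: (@le_trans _ _ (nrm (f x xi))); last first.
  by have := opnorm_le (f x) xi; rewrite xi1 mulr1.
rewrite -(@ler_pXn2r _ 2) ?nnegrE ?nrm_ge0 //.
rewrite /x (star_hom_sum fhom) bop_sumE (bigD1 s) //= pythagoras.
  rewrite (star_homZ fhom) nrmZ nrm_mono mulr1 lerDl sqr_ge0 //.
rewrite dot_sumr big1 // => t ts; rewrite !(star_homZ fhom) dotZl dotZr.
rewrite (Gorth (g := box_row s) (h := box_row t)) ?mulr0 //.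
by rewrite (inj_eq (@box_row_inj _ _)) eq_sym.
Qed.

Let laurent_nrm_le m x : laurent u m x -> nrm x <= (m.*2.+1 ^ d)%:R * nrm (f x).
Proof.
move=> [c xE].
have -> : (m.*2.+1 ^ d)%:R * nrm (f x) = \sum_(t : {ffun 'I_d -> 'I_m.*2.+1}) nrm (f x).
  by rewrite sumr_const card_ffun !card_ord mulr_natl.
rewrite {1}xE; apply: (@le_trans _ _ (\sum_t nrm (c t *: umono u (box_row t)))).
  apply: (big_ind2 (fun (y : A) (r : R) => nrm y <= r)) => //.
    by rewrite nrm0.
  by move=> y r z s yr zs; apply: le_trans (nrmD _ _) _; rewrite lerD.
apply: ler_sum => t _; rewrite nrmZ.
apply: (@le_trans _ _ (complex.Re `|c t|)); last by rewrite xE coef_le.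
rewrite ler_piMr ?normc_def ?sqrtr_ge0 //; apply: nrm_isometry_le.
by case: (umono_unitary uu (box_row t)).
Qed.

(* The powers of a Laurent polynomial have polynomially many coefficients, each
   at most the norm of the power in the representation. *)
Lemma faithful_nrm x : nrm (f x) = nrm x.
Proof.
apply/eqP; rewrite eq_le (star_hom_contraction fhom) /=.
have sa m y : laurent u m y -> star y = y -> nrm y <= nrm (f y).
  move=> my ys; apply: (@le_of_le_exp2n _ _ _ (m.*2.+1)%:R d); rewrite ?nrm_ge0 // => k.
  rewrite -!nrm_sa_exp -?(star_hom_star fhom) ?ys // -(star_homX fhom).
  apply: le_trans (laurent_nrm_le (laurentX uu uc (2 ^ k) my)) _.
  rewrite ler_wpM2r ?nrm_ge0 // -natrX -natrM [in leLHS]natrX.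
  apply: lerXn2r; rewrite ?nnegrE ?ler0n // ler_nat.
  by have := expn_gt0 2 k; nia.
have la m y : laurent u m y -> nrm y <= nrm (f y).
  move=> my; rewrite -(@ler_pXn2r _ 2) ?nnegrE ?nrm_ge0 //.
  rewrite -!nrm_starM -(star_hom_star fhom) -(star_homM fhom).
  apply: (sa (m + m)%N); last by rewrite starM starK.
  by apply: laurentM => //; exact: laurent_star.
apply/ler_addgt0Pl => e e0; have e2 : 0 < e / 2 by rewrite divr_gt0.
have [m [y [/la my xy]]] := laurent_dense uu uc ug x e2.
have h1 := nrmD (x - y) y; have h2 := nrmD (f (y - x)) (f x).
have := star_hom_contraction fhom (y - x).
move: h1 h2; rewrite subrK -(star_homD fhom) subrK nrmB.
move: my xy; rewrite nrmB; lra.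
Qed.

(** As [f] is isometric, its image is complete, hence closed, and equals the algebra generated by
    the images of the [u i]. The isomorphism is the inverse of [f], with arbitrary values off the
    image. *)
Lemma faithful_equiv : tuple_equiv (fun i => f (u i)) u.
Proof.
pose v i := f (u i).
have fI x y : f x = f y -> x = y.
  move=> e; apply/eqP; rewrite -subr_eq0; apply/eqP/nrm_eq0.
  by rewrite -faithful_nrm (star_homB fhom) e subrr nrm0.
have vS : closed_star_subalgebra (cstar_gen v).
  split; last by apply: closed_bigI => S [[_ ?] _].
  split=> [|x y vx vy|a x vx|x y vx vy|x vx] S SS; have [[[S1 S2 S3 S4 S5] _] _] := SS.
  - exact: S1.
  - exact: S2 (vx _ SS) (vy _ SS).
  - exact: S3 (vx _ SS).
  - exact: S4 (vx _ SS) (vy _ SS).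
  - exact: S5 (vx _ SS).
have vf x : cstar_gen v (f x).
  have : cstar_gen u x by rewrite ug.
  move=> /(_ [set x | cstar_gen v (f x)]) h; apply: h; split.
    case: vS => -[S1 S2 S3 S4 S5] Sc; split; last first.
      apply/closed_nrmP => y h; move/closed_nrmP : Sc; apply => e /h[z Sz yz].
      by exists (f z); rewrite // -(star_homB fhom) faithful_nrm.
    split=> [|y z vy vz|a y vy|y z vy vz|y vy] /=.
    - by rewrite (star_hom1 fhom).
    - by rewrite (star_homD fhom); exact: S2.
    - by rewrite (star_homZ fhom); exact: S3.
    - by rewrite (star_homM fhom); exact: S4.
    - by rewrite (star_hom_star fhom); exact: S5.
  by move=> _ [i _ <-] S [_ Sv]; apply: Sv; exists i.
have fv T : cstar_gen v T -> exists x, f x = T.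
  move=> /(_ [set T | exists x, f x = T]) h; apply: h; split; last first.
    by move=> _ [i _ <-]; exists (u i).
  split; last first.
    apply/closed_nrmP => T' h.
    have /choice[y yT] (n : nat) : exists y, nrm (T' - f y) < n.+1%:R^-1.
      by have [|_ [y <-] yT] := h n.+1%:R^-1; rewrite ?invr_gt0 //; exists y.
    have yc : cauchy (y @ \oo).
      apply: cauchy_nrm => e e0; have e2 : 0 < e / 2 by rewrite divr_gt0.
      have [N _ hN] := near_infty_natSinv_lt (PosNum e2).
      exists (y N); exists N => // n /= Nn.
      rewrite -faithful_nrm (star_homB fhom) -(subrKA T').
      apply: le_lt_trans (nrmD _ _) _; rewrite (splitr e) ltrD //.
        by rewrite nrmB; apply: lt_trans (yT N) (hN N (leqnn N)).
      exact: lt_trans (yT n) (hN n Nn).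
    have [z /near_nrm_lt yz] : exists z : A, y n @[n --> \oo] --> z.
      by exists (lim (y n @[n --> \oo])); exact: cauchy_cvg.
    exists z; apply/eqP; rewrite -subr_eq0; apply/eqP/nrm_eq0/eqP.
    rewrite eq_le nrm_ge0 andbT; apply/ler_addgt0Pl => e e0; rewrite addr0.
    have e2 : 0 < e / 2 by rewrite divr_gt0.
    have [N1 _ h1] := near_infty_natSinv_lt (PosNum e2); have [N2 _ h2] := yz _ e2.
    have {}h1 : _ < e / 2 := h1 _ (leq_maxl N1 N2).
    have {}h2 : nrm (z - y _) < _ := h2 _ (leq_maxr N1 N2).
    rewrite -(subrKA (f (y (maxn N1 N2)))) -(star_homB fhom); apply: le_trans (nrmD _ _) _.
    rewrite faithful_nrm nrmB (splitr e); apply: lerD; first by rewrite nrmB ltW.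
    by rewrite nrmB; apply: ltW (lt_trans (yT _) h1).
  split=> [|_ _ [x <-] [y <-]|a _ [x <-]|_ _ [x <-] [y <-]|_ [x <-]] /=.
  - by exists 1; exact: star_hom1.
  - by exists (x + y); exact: star_homD.
  - by exists (a *: x); exact: star_homZ.
  - by exists (x * y); exact: star_homM.
  - by exists (star x); exact: star_hom_star.
have [k kf] : exists k : bop H -> A, forall x, k (f x) = x.
  have /choice[k hk] T : exists x, cstar_gen v T -> f x = T.
    by have [/fv[x xT]|nT] := pselect (cstar_gen v T); [exists x|exists 0].
  by exists k => x; apply: fI; exact: hk.
exists k; split=> [|| i]; last exact: kf.
  split=> [|_ _ /fv[x <-] /fv[y <-]|a _ /fv[x <-]|_ _ /fv[x <-] /fv[y <-]|_ /fv[x <-]].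
  - by rewrite -(star_hom1 fhom) kf.
  - by rewrite -(star_homD fhom) !kf.
  - by rewrite -(star_homZ fhom) !kf.
  - by rewrite -(star_homM fhom) !kf.
  - by rewrite -(star_hom_star fhom) !kf.
split=> [T _|T T' /set_mem/fv[x <-] /set_mem/fv[y <-]|x _] /=; first by rewrite ug.
  by rewrite !kf => ->.
by exists (f x); [exact: vf|exact: kf].
Qed.

End Faithful.

(** * Hilbert-space-valued l2 spaces *)

Section NonnegativeSums.
Variables (R : realType) (I : choiceType).
Implicit Types (f g : I -> R).

(** Sums over an arbitrary index type go through [\esum]; the estimates on them reduce to finite
    sums over duplicate-free sequences. *)
Definition sfin f := ((\esum_(i in [set: I]) (f i)%:E) < +oo)%E.
Definition ssum f : R := fine (\esum_(i in [set: I]) (f i)%:E)%E.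

Lemma esum_ssum f : (forall i, 0 <= f i) -> sfin f ->
  (\esum_(i in [set: I]) (f i)%:E)%E = (ssum f)%:E.
Proof.
move=> f0 ff; rewrite fineK // ge0_fin_numE //.
by apply: esum_ge0 => i _; rewrite lee_fin.
Qed.

Lemma esum_leP f (B : R) : (forall s, uniq s -> \sum_(i <- s) f i <= B) ->
  (\esum_(i in [set: I]) (f i)%:E <= B%:E)%E.
Proof.
move=> h; apply: ge_ereal_sup => _ [X [Xf _] <-].
by rewrite fsbig_finite // sumEFin lee_fin h // fset_uniq.
Qed.

Lemma sfinP f (B : R) : (forall s, uniq s -> \sum_(i <- s) f i <= B) -> sfin f.
Proof. by move=> /esum_leP/le_lt_trans; apply; rewrite ltry. Qed.

Lemma ssum_le_bound f (B : R) : (forall i, 0 <= f i) ->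
  (forall s, uniq s -> \sum_(i <- s) f i <= B) -> ssum f <= B.
Proof. by move=> f0 h; rewrite -lee_fin -esum_ssum ?esum_leP //; exact: sfinP h. Qed.

Lemma sum_le_ssum f s : (forall i, 0 <= f i) -> sfin f -> uniq s ->
  \sum_(i <- s) f i <= ssum f.
Proof.
move=> f0 ff us; rewrite -lee_fin -esum_ssum //; apply: esum_ge.
exists [set` s]; first by split=> //; exact: finite_seq.
by rewrite -sumEFin fsbig_seq.
Qed.

Lemma ssum_ge0 f : (forall i, 0 <= f i) -> 0 <= ssum f.
Proof. by move=> f0; apply/fine_ge0/esum_ge0 => i _; rewrite lee_fin. Qed.

Lemma le_ssum_term f i : (forall i, 0 <= f i) -> sfin f -> f i <= ssum f.
Proof.
by move=> f0 ff; have := @sum_le_ssum f [:: i] f0 ff; rewrite big_seq1; apply.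
Qed.

Lemma sfin_le f g : (forall i, f i <= g i) -> sfin g -> sfin f.
Proof. by move=> fg; apply: le_lt_trans; apply: le_esum => i _; rewrite lee_fin. Qed.

Lemma ssum_le f g : (forall i, 0 <= f i) -> (forall i, f i <= g i) -> sfin g ->
  ssum f <= ssum g.
Proof.
move=> f0 fg gf; have g0 i : 0 <= g i by exact: le_trans (fg i).
rewrite -lee_fin -!esum_ssum //; last exact: sfin_le gf.
by apply: le_esum => i _; rewrite lee_fin.
Qed.

Lemma sfinD f g : (forall i, 0 <= f i) -> (forall i, 0 <= g i) ->
  sfin f -> sfin g -> sfin (fun i => f i + g i).
Proof.
move=> f0 g0 ff gf; rewrite /sfin.
rewrite (eq_esum (b := fun i => (f i)%:E + (g i)%:E)%E) => [|i _]; last by [].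
by rewrite esumD ?lte_add_pinfty // => i _; rewrite lee_fin.
Qed.

Lemma ssumD f g : (forall i, 0 <= f i) -> (forall i, 0 <= g i) ->
  sfin f -> sfin g -> ssum (fun i => f i + g i) = ssum f + ssum g.
Proof.
move=> f0 g0 ff gf; have fg0 i : 0 <= f i + g i by rewrite addr_ge0.
apply: EFin_inj; rewrite -(esum_ssum fg0 (sfinD f0 g0 ff gf)) EFinD -!esum_ssum //.
rewrite -esumD; first exact: eq_esum.
  by move=> i _; rewrite lee_fin.
by move=> i _; rewrite lee_fin.
Qed.

Lemma eq_ssum f g : f =1 g -> ssum f = ssum g.
Proof. by move=> /funext->. Qed.

Lemma eq_sfin f g : f =1 g -> sfin f -> sfin g.
Proof. by move=> /funext->. Qed.

Let ssumZ_le c f : 0 <= c -> (forall i, 0 <= f i) -> sfin f ->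
  ssum (fun i => c * f i) <= c * ssum f.
Proof.
move=> c0 f0 ff; apply: ssum_le_bound => [i|s us]; first by rewrite mulr_ge0.
by rewrite -mulr_sumr ler_wpM2l // sum_le_ssum.
Qed.

Lemma sfinZ c f : 0 <= c -> (forall i, 0 <= f i) -> sfin f -> sfin (fun i => c * f i).
Proof.
move=> c0 f0 ff; apply: (@sfinP _ (c * ssum f)) => s us.
by rewrite -mulr_sumr ler_wpM2l // sum_le_ssum.
Qed.

Lemma ssumZ c f : 0 <= c -> (forall i, 0 <= f i) -> sfin f ->
  ssum (fun i => c * f i) = c * ssum f.
Proof.
move=> c0 f0 ff; apply/eqP; rewrite eq_le ssumZ_le //=.
have [->|cn] := eqVneq c 0.
  by rewrite mul0r; apply: ssum_ge0 => i; rewrite mul0r.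
have cp : 0 < c by rewrite lt_neqAle eq_sym cn.
rewrite -ler_pdivlMl //.
rewrite {1}(eq_ssum (g := fun i => c^-1 * (c * f i))).
  apply: ssumZ_le; rewrite ?invr_ge0 //; last exact: sfinZ.
  by move=> i; rewrite mulr_ge0.
by move=> i; rewrite mulKf.
Qed.

Lemma ssum_bij f (e : I -> I) : bijective e -> ssum (f \o e) = ssum f.
Proof.
move=> be; rewrite /ssum -(@reindex_esum _ _ _ [set: I] [set: I] e (fun i => (f i)%:E)) //.
by rewrite setTT_bijective.
Qed.

Lemma sfin_bij f (e : I -> I) : bijective e -> sfin f -> sfin (f \o e).
Proof.
move=> be; rewrite /sfin (@reindex_esum _ _ _ [set: I] [set: I] e) //.
by rewrite setTT_bijective.
Qed.

End NonnegativeSums.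

Section EmbeddedSums.
Variables (R : realType) (I J : choiceType) (f : J -> R) (e : I -> J).
Hypotheses (ei : injective e) (f0 : forall j, (forall i, j != e i) -> f j = 0).

Let esum_inj : (\esum_(j in [set: J]) (f j)%:E)%E = (\esum_(i in [set: I]) (f (e i))%:E)%E.
Proof.
rewrite -(@reindex_esum _ _ _ [set: I] (range e) e (fun j => (f j)%:E)).
  rewrite [RHS]esum_mkcond; apply: eq_esum => j _; case: ifPn => // /negP je.
  rewrite f0 // => i; apply: contra_notN je => /eqP->.
  by apply/mem_set; exists i.
by apply: inj_bij => x y _ _; exact: ei.
Qed.

Lemma ssum_inj : ssum f = ssum (f \o e).
Proof. by rewrite /ssum esum_inj. Qed.

Lemma sfin_inj : sfin (f \o e) -> sfin f.
Proof. by rewrite /sfin esum_inj. Qed.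

End EmbeddedSums.

(** The complex line as a Hilbert space, under a name of its own so that the new structures are not
    attached to [R[i]] itself. *)
Definition cplane (R : realType) : Type := R[i].

Section ComplexHilbert.
Variable R : realType.

HB.instance Definition _ := NormedModule.copy (cplane R) R[i]^o.

Let cplane_complete (F : set_system (cplane R)) : ProperFilter F -> cauchy F -> cvg F.
Proof.
move=> FF Fc.
have part (h : R[i] -> R) : (forall x y, h (x - y) = h x - h y) ->
    (forall x, `|h x| <= nrm (x : cplane R)) ->
    exists l : R, forall e : R, 0 < e -> F [set x | `|l - h x| < e].
  move=> hB hn.
  have hc : cauchy (h @ F).
    apply/cauchyP => e e0; have [B FB hB2] := cauchy_nrmP FF Fc e0.
    have [y By] := filter_ex FB; exists (h y).
    rewrite /=; apply: filterS FB => z Bz.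
    rewrite /= -ball_normE /ball_ /= -hB; apply: le_lt_trans (hn _) _.
    exact: hB2 By Bz.
  have hl : h @ F --> lim (h @ F) by exact: cauchy_cvg hc.
  by exists (lim (h @ F)) => e e0; move/cvgrPdist_lt : hl => /(_ e e0).
have nRe (x : R[i]) : `|complex.Re x| <= nrm (x : cplane R).
  by rewrite /nrm; case: x => b c; rewrite normc_def /= -sqrtr_sqr ler_wsqrtr // lerDl sqr_ge0.
have nIm (x : R[i]) : `|complex.Im x| <= nrm (x : cplane R).
  by rewrite /nrm; case: x => b c; rewrite normc_def /= -sqrtr_sqr ler_wsqrtr // lerDr sqr_ge0.
have [a Fa] := part (@complex.Re R) (raddfB _) nRe.
have [b Fb] := part (@complex.Im R) (raddfB _) nIm.
apply/cvg_ex; exists (a +i* b)%C; apply/near_nrm_lt => e e0.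
have e2 : 0 < e / 2 by rewrite divr_gt0.
apply: filterS (filterI (Fa _ e2) (Fb _ e2)) => -[x y] /= [h1 h2].
rewrite /nrm normc_def /=.
rewrite -(ger0_norm (ltW e0)) -sqrtr_sqr ltr_sqrt ?exprn_gt0 //.
rewrite -[(a - x) ^+ 2]real_normK ?num_real // -[(b - y) ^+ 2]real_normK ?num_real //.
move: (normr_ge0 (a - x)) (normr_ge0 (b - y)) h1 h2.
move: (`|_|) (`|_|) => s t; nra.
Qed.

HB.instance Definition _ := Uniform_isComplete.Build (cplane R) cplane_complete.

Let cdot (x y : cplane R) : R[i] := (x : R[i]) * (y : R[i])^*%C.

Let cdot_linear z : scalar (cdot^~ z).
Proof. by move=> a x y; rewrite /cdot mulrDl mulrA. Qed.

Let cdotC x y : cdot x y = (cdot y x)^*%C.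
Proof. by rewrite /cdot rmorphM /= conjcK mulrC. Qed.

Let cdotxx x : cdot x x = `|x| ^+ 2.
Proof. by rewrite /cdot -sqr_normc. Qed.

HB.instance Definition _ := isHilbert.Build R (cplane R) cdot_linear cdotC cdotxx.

End ComplexHilbert.

Section Ell2.
Variables (R : realType) (I : choiceType) (M : hilbertType R).

Definition sqnrm (x : I -> M) (i : I) : R := nrm (x i) ^+ 2.

Lemma sqnrm_ge0 x i : 0 <= sqnrm x i.
Proof. exact: sqr_ge0. Qed.

Record ell2 := Ell2 { ell2_fun :> I -> M; ell2_fin : sfin (sqnrm ell2_fun) }.

Implicit Types x y z : ell2.

Lemma ell2_ext x y : x =1 y -> x = y.
Proof.
case: x y => [x xf] [y yf] /= /funext xy; case: _ / xy in yf *.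
by rewrite (Prop_irrelevance xf yf).
Qed.

Let sqD (a b : M) : nrm (a + b) ^+ 2 <= 2 * nrm a ^+ 2 + 2 * nrm b ^+ 2.
Proof.
have := nrmD a b; have := nrm_ge0 (a + b); have := sqr_ge0 (nrm a - nrm b).
by move: (nrm a) (nrm b) (nrm _) => *; nra.
Qed.

Let finD (x y : I -> M) : sfin (sqnrm x) -> sfin (sqnrm y) -> sfin (sqnrm (fun i => x i + y i)).
Proof.
move=> xf yf; apply: (@sfin_le _ _ _ (fun i => 2 * sqnrm x i + 2 * sqnrm y i)).
  by move=> i; exact: sqD.
by apply: sfinD; try (by move=> i; rewrite mulr_ge0 ?sqnrm_ge0);
  apply: sfinZ => //; exact: sqnrm_ge0.
Qed.

Let sqZ (a : R[i]) (b : M) : nrm (a *: b) ^+ 2 = complex.Re `|a| ^+ 2 * nrm b ^+ 2.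
Proof. by rewrite nrmZ exprMn. Qed.

Let finZ (a : R[i]) (x : I -> M) : sfin (sqnrm x) -> sfin (sqnrm (fun i => a *: x i)).
Proof.
move=> xf; apply: (eq_sfin (fun i => esym (sqZ a (x i)))).
by apply: sfinZ => //; [exact: sqr_ge0|exact: sqnrm_ge0].
Qed.

Let finN (x : I -> M) : sfin (sqnrm x) -> sfin (sqnrm (fun i => - x i)).
Proof. by apply: eq_sfin => i; rewrite /sqnrm nrmN. Qed.

Let fin0 : sfin (sqnrm (fun=> 0)).
Proof.
apply: (@sfinP _ _ _ 0) => s _; rewrite big1 // => i _.
by rewrite /sqnrm nrm0 expr0n.
Qed.

HB.instance Definition _ := gen_eqMixin ell2.
HB.instance Definition _ := gen_choiceMixin ell2.

Let add x y := Ell2 (finD (ell2_fin x) (ell2_fin y)).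
Let opp x := Ell2 (finN (ell2_fin x)).
Let zero := Ell2 fin0.
Let scale (a : R[i]) x := Ell2 (finZ a (ell2_fin x)).

Let addA : associative add.
Proof. by move=> x y z; apply: ell2_ext => i /=; rewrite addrA. Qed.
Let addC : commutative add.
Proof. by move=> x y; apply: ell2_ext => i /=; rewrite addrC. Qed.
Let add0 : left_id zero add.
Proof. by move=> x; apply: ell2_ext => i /=; rewrite add0r. Qed.
Let addN : left_inverse zero opp add.
Proof. by move=> x; apply: ell2_ext => i /=; rewrite addNr. Qed.

HB.instance Definition _ := GRing.isZmodule.Build ell2 addA addC add0 addN.

Let scaleA a b x : scale a (scale b x) = scale (a * b) x.
Proof. by apply: ell2_ext => i /=; rewrite scalerA. Qed.
Let scale1 : left_id 1 scale.
Proof. by move=> x; apply: ell2_ext => i /=; rewrite scale1r. Qed.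
Let scaleDr : right_distributive scale +%R.
Proof. by move=> a x y; apply: ell2_ext => i /=; rewrite scalerDr. Qed.
Let scaleDl x : {morph scale^~ x : a b / a + b}.
Proof. by move=> a b; apply: ell2_ext => i /=; rewrite scalerDl. Qed.

HB.instance Definition _ := GRing.Zmodule_isLmodule.Build R[i] ell2
  scaleA scale1 scaleDr scaleDl.

Let N x : R := ssum (sqnrm x).

Let N_ge0 x : 0 <= N x. Proof. exact: ssum_ge0 (sqnrm_ge0 x). Qed.

Let NZ (a : R[i]) x : N (a *: x) = complex.Re `|a| ^+ 2 * N x.
Proof.
rewrite /N -ssumZ; last exact: ell2_fin.
- by apply: eq_ssum => i; rewrite /sqnrm /= nrmZ exprMn.
- exact: sqr_ge0.
- exact: sqnrm_ge0.
Qed.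

Let sfin_lin x y (a b : R) : 0 <= a -> 0 <= b ->
  sfin (fun i => a * nrm (x i) ^+ 2 + b * nrm (y i) ^+ 2).
Proof.
move=> a0 b0; apply: (@sfinD _ _ (fun i => a * sqnrm x i) (fun i => b * sqnrm y i)).
- by move=> i; rewrite mulr_ge0 ?sqnrm_ge0.
- by move=> i; rewrite mulr_ge0 ?sqnrm_ge0.
- exact: (sfinZ a0 (sqnrm_ge0 x) (ell2_fin x)).
- exact: (sfinZ b0 (sqnrm_ge0 y) (ell2_fin y)).
Qed.

Let Nlin x y (a b : R) : 0 <= a -> 0 <= b ->
  a * N x + b * N y = ssum (fun i => a * nrm (x i) ^+ 2 + b * nrm (y i) ^+ 2).
Proof.
move=> a0 b0.
have h (c : R) z : 0 <= c -> sfin (fun i => c * sqnrm z i).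
  by move=> c0; apply: sfinZ => //; [exact: sqnrm_ge0|exact: ell2_fin].
have h0 (c : R) z : 0 <= c -> forall i, 0 <= c * sqnrm z i.
  by move=> c0 i; rewrite mulr_ge0 ?sqnrm_ge0.
rewrite (ssumD (h0 a x a0) (h0 b y b0) (h a x a0) (h b y b0)).
rewrite (ssumZ a0 (sqnrm_ge0 x) (ell2_fin x)).
by rewrite (ssumZ b0 (sqnrm_ge0 y) (ell2_fin y)).
Qed.

Let N_eq0 x : N x = 0 -> x = 0.
Proof.
move=> x0; apply: ell2_ext => i /=; apply/nrm_eq0/eqP.
rewrite -sqrf_eq0 eq_le sqr_ge0 andbT -x0.
exact: (le_ssum_term i (sqnrm_ge0 x) (ell2_fin x)).
Qed.

Let enorm x : R := Num.sqrt (N x).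

(** No inner product is available yet. The pointwise inequality |a + b|^2 <= (1 + s) |a|^2 + (1 +
    1/s) |b|^2 is summed, and s = |y| / |x| turns the result into (|x| + |y|)^2. *)
Let enormD x y : enorm (x + y) <= enorm x + enorm y.
Proof.
have [x0|xn] := eqVneq (N x) 0.
  by rewrite (N_eq0 x0) add0r lerDr sqrtr_ge0.
have [y0|yn] := eqVneq (N y) 0.
  by rewrite (N_eq0 y0) addr0 lerDl sqrtr_ge0.
have pos z : N z != 0 -> 0 < enorm z by move=> zn; rewrite sqrtr_gt0 lt_neqAle eq_sym zn N_ge0.
have {xn}xp := pos _ xn; have {yn}yp := pos _ yn.
pose s := enorm y / enorm x; have s0 : 0 < s by rewrite divr_gt0.
have h : N (x + y) <= (1 + s) * N x + (1 + s^-1) * N y.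
  rewrite Nlin ?addr_ge0 ?invr_ge0 ?(ltW s0) //.
  apply: ssum_le; first exact: sqnrm_ge0; last by apply: sfin_lin; rewrite addr_ge0 ?invr_ge0 ?(ltW s0).
  move=> i; rewrite /sqnrm /=.
  apply: (@le_trans _ _ ((nrm (x i) + nrm (y i)) ^+ 2)).
    by rewrite lerXn2r ?nnegrE ?addr_ge0 ?nrm_ge0 // nrmD.
  have [t ts] : exists t, s = t ^+ 2 by exists (Num.sqrt s); rewrite sqr_sqrtr // ltW.
  have tn : t != 0 by apply: contraTneq s0 => t0; rewrite ts t0 expr0n ltxx.
  rewrite ts -subr_ge0 (_ : _ - _ = (t * nrm (x i) - t^-1 * nrm (y i)) ^+ 2) ?sqr_ge0 //.
  by field.
rewrite -(@ler_pXn2r _ 2) ?nnegrE ?addr_ge0 ?sqrtr_ge0 // sqr_sqrtr ?N_ge0 //.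
apply: le_trans h _; rewrite /s -(sqr_sqrtr (N_ge0 x)) -(sqr_sqrtr (N_ge0 y)).
rewrite -/(enorm x) -/(enorm y) le_eqVlt; apply/orP; left; apply/eqP.
by field; rewrite !gt_eqF.
Qed.

Let enormDC x y : (enorm (x + y))%:C%C <= (enorm x)%:C%C + (enorm y)%:C%C.
Proof. by rewrite -rmorphD lecR /= enormD. Qed.

Let enormZC (a : R[i]) x : (enorm (a *: x))%:C%C = `|a| * (enorm x)%:C%C.
Proof.
have -> : `|a| = (complex.Re `|a|)%:C%C by rewrite normc_def.
rewrite -rmorphM; congr (_%:C%C); rewrite /enorm NZ sqrtrM ?sqr_ge0 // sqrtr_sqr.
by rewrite ger0_norm // normc_def sqrtr_ge0.
Qed.

Let enorm_eq0 x : (enorm x)%:C%C = 0 -> x = 0.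
Proof.
move=> /(congr1 (@complex.Re R)) /= x0; apply/N_eq0/eqP.
by rewrite eq_le N_ge0 andbT -sqrtr_eq0 -/(enorm x) x0.
Qed.

HB.instance Definition _ := Lmodule_isNormed.Build R[i] ell2 enormDC enormZC enorm_eq0.

Lemma ell2_nrm x : nrm x = Num.sqrt (ssum (sqnrm x)).
Proof. by []. Qed.

Lemma ell2_nrm2 x : nrm x ^+ 2 = ssum (sqnrm x).
Proof. by rewrite ell2_nrm sqr_sqrtr // N_ge0. Qed.

Lemma ell2_coord_le x i : nrm (x i) <= nrm x.
Proof.
rewrite -(@ler_pXn2r _ 2) ?nnegrE ?nrm_ge0 // ell2_nrm2.
exact: (le_ssum_term i (sqnrm_ge0 x) (ell2_fin x)).
Qed.

(** The limit is taken coordinatewise. Finite partial sums pass to the limit along the filter, and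
    their uniform bound 4 e^2 then controls the whole norm. *)
Let ell2_complete (F : set_system ell2) : ProperFilter F -> cauchy F -> cvg F.
Proof.
move=> FF Fc.
have Fi i : cauchy ((fun x : ell2 => x i) @ F).
  apply: cauchy_nrm => e e0; have [B FB hB] := cauchy_nrmP FF Fc e0.
  have [x Bx] := filter_ex FB; exists (x i).
  change (F [set y : ell2 | nrm (x i - y i) < e]).
  apply: filterS FB => y By /=; apply: le_lt_trans (ell2_coord_le (x - y) i) _.
  exact: hB.
pose f i : M := lim ((fun x : ell2 => x i) @ F).
have fP i (e : R) : 0 < e -> F [set x : ell2 | nrm (f i - x i) < e].
  have : (fun x : ell2 => x i) @ F --> f i by exact: cauchy_cvg (Fi i).
  by move/near_nrm_lt => h /h.
have fs (s : seq I) (e : R) : 0 < e ->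
    F [set x : ell2 | \sum_(i <- s) nrm (f i - x i) ^+ 2 < e].
  elim: s e => [|i s IH] e e0.
    by apply: filterS filterT => x _ /=; rewrite big_nil.
  have e2 : 0 < e / 2 by rewrite divr_gt0.
  have m0 : 0 < Num.min 1 (e / 2) by rewrite lt_min ltr01.
  apply: filterS (filterI (IH _ e2) (fP i _ m0)) => x /= [h1].
  rewrite lt_min big_cons => /andP[h2 h3].
  move: h1 h2 h3 (nrm_ge0 (f i - x i)).
  by move: (nrm _) (\sum_(_ <- _) _) => *; nra.
have fb (e : R) : 0 < e -> exists2 B, F B & forall x, B x ->
    forall s, uniq s -> \sum_(i <- s) nrm (f i - x i) ^+ 2 <= 4 * e ^+ 2.
  move=> e0; have [B FB hB] := cauchy_nrmP FF Fc e0; exists B => // x Bx s us.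
  have e20 : 0 < e ^+ 2 by rewrite exprn_gt0.
  have [y [h1 By]] := filter_ex (filterI (fs s _ e20) FB).
  apply: (@le_trans _ _ (\sum_(i <- s) (2 * nrm (f i - y i) ^+ 2 + 2 * nrm ((y - x) i) ^+ 2))).
    apply: ler_sum => i _; rewrite -(subrKA (y i)); exact: sqD.
  rewrite big_split /= -!mulr_sumr.
  have h2 : \sum_(i <- s) nrm ((y - x) i) ^+ 2 <= e ^+ 2.
    apply: le_trans (sum_le_ssum (sqnrm_ge0 (y - x)) (ell2_fin (y - x)) us) _.
    rewrite -ell2_nrm2 lerXn2r ?nnegrE ?nrm_ge0 ?(ltW e0) //; exact/ltW/hB.
  move: h1 h2 => /=; move: (\sum_(_ <- _) _) (\sum_(_ <- _) _) => a b; lra.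
have dfin (x : ell2) (B : R) : (forall s, uniq s -> \sum_(i <- s) nrm (f i - x i) ^+ 2 <= B) ->
    sfin (sqnrm (fun i => f i - x i)) by exact: sfinP.
have [B FB hB] := fb 1 ltr01; have [x Bx] := filter_ex FB.
have ff : sfin (sqnrm f).
  have := finD (dfin _ _ (hB x Bx)) (ell2_fin x).
  by apply: eq_sfin => i; rewrite /sqnrm subrK.
apply/cvg_ex; exists (Ell2 ff); apply/near_nrm_lt => e e0.
have e4 : 0 < e / 4 by rewrite divr_gt0.
have [C FC hC] := fb _ e4; apply: filterS FC => y Cy.
rewrite -(@ltr_pXn2r _ 2) ?nnegrE ?nrm_ge0 ?(ltW e0) // ell2_nrm2.
apply: (@le_lt_trans _ _ (4 * (e / 4) ^+ 2)); last first.
  have : 0 < e ^+ 2 by rewrite exprn_gt0.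
  by rewrite expr_div_n; move: (e ^+ 2) => a; lra.
by apply: ssum_le_bound => [i|s us]; [exact: sqnrm_ge0|exact: hC].
Qed.

HB.instance Definition _ := Uniform_isComplete.Build ell2 ell2_complete.

(** Only nonnegative families have been summed so far, so the real part of the inner product is
    recovered from the norm by polarization rather than as a signed series. *)
Let rd x y : R := (N (x + y) - N (x - y)) / 4.

Let NN x : N (- x) = N x.
Proof. by apply: eq_ssum => i; rewrite /sqnrm /= nrmN. Qed.

Let Ni x : N ('i%C *: x) = N x.
Proof. by rewrite NZ normc_def /= expr0n add0r expr1n sqrtr1 expr1n mul1r. Qed.

Let NE x y z (t : ell2) (b : R) : 0 <= b ->
  (forall i, nrm (x i) ^+ 2 + b * nrm (y i) ^+ 2 =
             nrm (z i) ^+ 2 + b * nrm (t i) ^+ 2) ->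
  N x + b * N y = N z + b * N t.
Proof.
move=> b0 h; rewrite -[N x]mul1r -[N z]mul1r !Nlin //.
by apply: eq_ssum => i; rewrite !mul1r.
Qed.

Let par x y : N (x + y) + N (x - y) = 2 * N x + 2 * N y.
Proof.
rewrite -[N (x + y)]mul1r -[N (x - y)]mul1r !Nlin //.
apply: eq_ssum => i; rewrite /= -!rdotxx.
by rewrite !(rdotDl, rdotDr, rdotNl, rdotNr) (rdotC (y i)); ring.
Qed.

Let rdC x y : rd x y = rd y x.
Proof. by rewrite /rd (addrC x) -(NN (x - y)) opprB. Qed.

(* Jordan-von Neumann: the parallelogram identity makes the polarization additive. *)
Let rdD x y z : rd (x + y) z = rd x z + rd y z.
Proof.
have h1 := par (x + z) y; have h2 := par (x - z) y.
have h3 := par (y + z) x; have h4 := par (y - z) x.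
have e1 : N (x + y + z) = N (x + z + y) by rewrite addrAC.
have e2 : N (x + y - z) = N (x - z + y) by rewrite addrAC.
have e3 : N (y + z + x) = N (x + z + y) by rewrite addrAC (addrC y) addrAC.
have e4 : N (y - z + x) = N (x - z + y) by rewrite addrAC (addrC y) addrAC.
have e5 : N (y + z - x) = N (x - z - y) by rewrite -(NN (y + z - x)) opprB (addrC y) opprD addrA.
have e6 : N (y - z - x) = N (x + z - y) by rewrite -(NN (y - z - x)) !opprB addrA.
rewrite /rd; move: h1 h2 h3 h4; rewrite e1 e2 e3 e4 e5 e6; lra.
Qed.

Let rdN x z : rd (- x) z = - rd x z.
Proof.
have e1 : N (- x + z) = N (x - z) by rewrite -(NN (- x + z)) opprD opprK.
have e2 : N (- x - z) = N (x + z) by rewrite -(NN (x + z)) opprD.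
by rewrite /rd e1 e2; lra.
Qed.

(** For a >= 0 homogeneity follows from a coordinatewise identity between nonnegative terms, |a x +
    z|^2 + a |x - z|^2 = |a x - z|^2 + a |x + z|^2, with no passage through rational scalars. *)
Let rdZ (a : R) x z : rd (a%:C%C *: x) z = a * rd x z.
Proof.
wlog a0 : a / 0 <= a => [h|].
  have [/h//|/ltW] := leP 0 a; rewrite -oppr_ge0 => /h.
  by rewrite rmorphN scaleNr rdN mulNr => /oppr_inj.
have : N (a%:C%C *: x + z) + a * N (x - z) = N (a%:C%C *: x - z) + a * N (x + z).
  apply: (NE a0) => i /=; rewrite -!rdotxx.
  rewrite !(rdotDl, rdotDr, rdotNl, rdotNr, rdotZl, rdotZr) (rdotC (z i)); ring.
by rewrite /rd => h; lra.
Qed.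

(** The product is conjugate linear on the right, so the real part of <x, i y> = - i <x, y> is the
    imaginary part of <x, y>. *)
Let edot x y : R[i] := (rd x y +i* rd x ('i%C *: y))%C.

Let ii x : 'i%C *: ('i%C *: x) = - x :> ell2.
Proof. by rewrite scalerA -expr2 sqr_i scaleN1r. Qed.

Let rdi x z : rd ('i%C *: x) z = - rd x ('i%C *: z).
Proof.
have e1 : N ('i%C *: x + z) = N (x - 'i%C *: z).
  by rewrite -(Ni (x - _)) scalerBr ii opprK.
have e2 : N ('i%C *: x - z) = N (x + 'i%C *: z).
  by rewrite -(Ni (x + _)) scalerDr ii.
by rewrite /rd e1 e2; lra.
Qed.

Let edot_linear z : scalar (edot^~ z).
Proof.
move=> a x y; apply/eqP; rewrite /edot !rdD; case: a => a b.
have -> : (a +i* b)%C *: x = a%:C%C *: x + b%:C%C *: ('i%C *: x).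
  rewrite scalerA -scalerDl; congr (_ *: _); apply/eqP; rewrite eq_complex /=.
  by apply/andP; split; apply/eqP; ring.
rewrite !rdD !rdZ !rdi ii [rd _ (- _)]rdC rdN [rd z x]rdC eq_complex /=.
by rewrite opprK mulrN eqxx andTb; apply/eqP; ring.
Qed.

Let edotC x y : edot x y = (edot y x)^*%C.
Proof. by rewrite /edot /= [rd y x]rdC [rd y _]rdC rdi opprK. Qed.

Let edotxx x : edot x x = `|x| ^+ 2.
Proof.
rewrite nrmE -rmorphXn /= ell2_nrm2 -/(N x) /edot; apply/eqP; rewrite eq_complex /=.
have h : rd x ('i%C *: x) = - rd x ('i%C *: x) by rewrite -rdi rdC.
have -> : rd x ('i%C *: x) = 0 by lra.
rewrite eqxx andbT /rd subrr -mulr2n -scaler_nat NZ.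
have -> : N 0 = 0 by rewrite -(scale0r 0) NZ normr0 expr0n mul0r.
rewrite -(rmorph_nat (real_complex R)) normc_def /= expr0n addr0 sqrtr_sqr.
by rewrite ger0_norm //; apply/eqP; field.
Qed.

HB.instance Definition _ := isHilbert.Build R ell2 edot_linear edotC edotxx.

End Ell2.

(** * Operators on l2 *)

Section Isometries.
Variables (R : realType) (H : hilbertType R).
Implicit Types (x y : H) (S T : bop H).

Lemma bopB T x y : T (x - y) = T x - T y.
Proof. by rewrite bopD -scaleN1r bopZ scaleN1r. Qed.

Lemma polarization x y : 4 * rdot x y = nrm (x + y) ^+ 2 - nrm (x - y) ^+ 2.
Proof.
by rewrite -!rdotxx !(rdotDl, rdotDr, rdotNl, rdotNr) (rdotC y x); ring.
Qed.

Lemma dot_rdot x y : dot x y = (rdot x y +i* rdot x ('i%C *: y))%C.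
Proof.
rewrite /rdot dotZr; case: (dot x y) => a b; apply/eqP; rewrite eq_complex /=.
by rewrite eqxx /= mul0r mulN1r opprK add0r.
Qed.

Lemma isometry_starM T : (forall x, nrm (T x) = nrm x) -> star T * T = 1.
Proof.
move=> Ti; apply: bop_ext => x; apply: dot_ext => h.
change (rdot h (star T (T x)) = rdot h x).
rewrite /rdot -dot_star -!/(rdot _ _).
have : 4 * rdot (T h) (T x) = 4 * rdot h x.
  by rewrite !polarization -bopB -bopD !Ti.
lra.
Qed.

Lemma isometry_inv_star S T :
  (forall x, nrm (T x) = nrm x) -> T * S = 1 -> star T = S.
Proof.
by move=> /isometry_starM TT TS; rewrite -[LHS]mulr1 -TS mulrA TT mul1r.
Qed.

Lemma surj_isometry_unitary S T :
  (forall x, nrm (T x) = nrm x) -> T * S = 1 -> unitary T.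
Proof.
move=> Ti TS; split; first exact: isometry_starM Ti.
by rewrite (isometry_inv_star Ti TS).
Qed.

Lemma starM_eq0 S T : (forall x y, dot (S x) (T y) = 0) -> star S * T = 0.
Proof.
move=> ST; apply: bop_ext => y; apply: dot_inj => x.
change (dot x (star S (T y)) = dot x 0).
by rewrite -dot_star ST dotC dot0l conjc0.
Qed.

Lemma bop_nrm_le T (c : R) : 0 <= c -> (forall x, nrm (T x) <= c * nrm x) -> nrm T <= c.
Proof. by move=> c0 h; rewrite nrm_bop; exact: opnorm_ub. Qed.

End Isometries.

Section Ell2Operators.
Variables (R : realType) (I : choiceType) (M : hilbertType R).
Local Notation H := (ell2 I M).
Implicit Types x y : H.

Lemma ell2_disjoint_dot x y : (forall i, x i = 0 \/ y i = 0) -> dot x y = 0.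
Proof.
have h (z : H) : (forall i, x i = 0 \/ z i = 0) -> rdot x z = 0.
  move=> xz; suff : 4 * rdot x z = 0 by lra.
  rewrite polarization !ell2_nrm2 (eq_ssum (g := sqnrm (x - z))) ?subrr // => i.
  by rewrite /sqnrm /=; case: (xz i) => ->; rewrite ?add0r ?addr0 ?subr0 ?nrmN // oppr0 addr0.
move=> xy; rewrite dot_rdot !h // => i; case: (xy i) => [->|yi]; [by left|right].
by rewrite /= yi scaler0.
Qed.

Lemma ell2_le (e : I -> I) (c : R) x y : bijective e -> 0 <= c ->
  (forall i, nrm (y i) <= c * nrm (x (e i))) -> nrm y <= c * nrm x.
Proof.
move=> be c0 h; rewrite -(@ler_pXn2r _ 2) ?nnegrE ?mulr_ge0 ?nrm_ge0 //.
rewrite exprMn !ell2_nrm2 -[ssum (sqnrm x)](ssum_bij _ be) -ssumZ ?sqr_ge0 //.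
- apply: ssum_le => [i|i|]; first exact: sqnrm_ge0.
    by rewrite /sqnrm /= -exprMn; apply: lerXn2r; rewrite ?nnegrE ?mulr_ge0 ?nrm_ge0.
  apply: (sfinZ (sqr_ge0 c)) => [i|]; first exact: sqnrm_ge0.
  exact: sfin_bij be (ell2_fin x).
- by move=> i; exact: sqnrm_ge0.
- exact: sfin_bij be (ell2_fin x).
Qed.

Lemma ell2_isometry (e : I -> I) x y : bijective e ->
  (forall i, nrm (y i) = nrm (x (e i))) -> nrm y = nrm x.
Proof.
move=> be h; rewrite !ell2_nrm -[in RHS](ssum_bij _ be); congr (Num.sqrt _).
by apply: eq_ssum => i; rewrite /sqnrm /= h.
Qed.

Section WeightedShift.
Variables (W : I -> bop M) (c : R) (e : I -> I).
Hypotheses (Wc : forall i, nrm (W i) <= c) (be : bijective e).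

Let Wle i (z : M) : nrm (W i z) <= c * nrm z.
Proof.
by apply: le_trans (opnorm_le _ _) _; rewrite ler_wpM2r ?nrm_ge0 // -nrm_bop.
Qed.

Let wfin x : sfin (sqnrm (fun i => W i (x (e i)))).
Proof.
apply: (@sfin_le _ _ _ (fun i => c ^+ 2 * sqnrm x (e i))) => [i|].
  rewrite /sqnrm -exprMn; apply: lerXn2r (Wle _ _); rewrite nnegrE ?nrm_ge0 //.
  exact: le_trans (nrm_ge0 _) (Wle _ _).
apply: (sfinZ (sqr_ge0 c)) => [i|]; first exact: sqnrm_ge0.
exact: sfin_bij be (ell2_fin x).
Qed.

Let wlin : linear (fun x => Ell2 (wfin x)).
Proof. by move=> a x y; apply: ell2_ext => i /=; rewrite bop_linear. Qed.

Let wbound : exists K : R, forall x, nrm (Ell2 (wfin x)) <= K * nrm x.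
Proof.
exists `|c| => x; apply: (ell2_le be) => // i /=.
by apply: le_trans (Wle _ _) _; rewrite ler_wpM2r ?nrm_ge0 // ler_norm.
Qed.

(** Covers both kinds of operators used later: twisted shifts, with scalar weights and [e] a
    translation, and block diagonal operators, with [e] the identity. *)
Definition wshift : bop H := Bop wlin wbound.

End WeightedShift.

Lemma pushforward (e : I -> I) : injective e -> exists T : bop H,
  [/\ forall x i, T x (e i) = x i,
      forall x j, (forall i, j != e i) -> T x j = 0 &
      forall x, nrm (T x) = nrm x].
Proof.
move=> ei.
have /choice[p hp] j : exists p : option I,
    if p is Some i then j = e i else forall i, j != e i.
  have [[i ->]|h] := pselect (exists i, j = e i); first by exists (Some i).
  by exists None => i; apply/eqP => ji; apply: h; exists i.
pose f (x : H) j : M := if p j is Some i then x i else 0.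
have fe x i : f x (e i) = x i.
  by rewrite /f; have := hp (e i); case: (p (e i)) => [k /ei->//|/(_ i)]; rewrite eqxx.
have f0 x j : (forall i, j != e i) -> f x j = 0.
  by rewrite /f; have := hp j; case: (p j) => // k -> /(_ k); rewrite eqxx.
have s0 x j : (forall i, j != e i) -> sqnrm (f x) j = 0.
  by move=> /f0 h; rewrite /sqnrm h nrm0 expr0n.
have fe2 x : sqnrm (f x) \o e =1 sqnrm x by move=> i; rewrite /sqnrm /= fe.
have ff x : sfin (sqnrm (f x)).
  apply: (sfin_inj ei (s0 x)); apply: eq_sfin (ell2_fin x) => i.
  by rewrite fe2.
have fn x : nrm (Ell2 (ff x)) = nrm x.
  by rewrite !ell2_nrm (ssum_inj ei (s0 x)) (eq_ssum (fe2 x)).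
have flin : linear (fun x => Ell2 (ff x)).
  move=> a x y; apply: ell2_ext => j /=; rewrite /f; case: (p j) => //.
  by rewrite scaler0 addr0.
have fb : exists K : R, forall x, nrm (Ell2 (ff x)) <= K * nrm x.
  by exists 1 => x; rewrite fn mul1r.
by exists (Bop flin fb).
Qed.

Lemma pullback (e : I -> I) x : injective e -> exists y, forall i, y i = x (e i).
Proof.
move=> ei; have h : sfin (sqnrm (fun i => x (e i))).
  apply: (@sfinP _ _ _ (ssum (sqnrm x))) => s us.
  have := sum_le_ssum (sqnrm_ge0 x) (ell2_fin x) (_ : uniq (map e s)).
  by rewrite big_map map_inj_uniq //; apply.
by exists (Ell2 h).
Qed.

End Ell2Operators.

(** * Isometries with orthogonal ranges *)

Section Cuntz.
Variables (R : realType) (M : hilbertType R).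
Local Notation H := (ell2 nat M).

(** [S k] spreads the coordinates over one residue class modulo [#|K|]; distinct classes are
    disjoint. *)
Lemma orthogonal_isometries (K : finType) : exists S : K -> bop H,
  forall k l, star (S k) * S l = (k == l)%:R.
Proof.
pose e (k : K) m := (m * #|K| + enum_rank k)%N.
have eI k l m n : e k m = e l n -> (k = l) /\ (m = n).
  move=> h; have /= hk := ltn_ord (enum_rank k); have /= hl := ltn_ord (enum_rank l).
  have K0 : (0 < #|K|)%N by apply: leq_ltn_trans hk.
  have := congr1 (modn^~ #|K|) h; rewrite /e !modnMDl !modn_small // => /val_inj/enum_rank_inj kl.
  by have := congr1 (divn^~ #|K|) h; rewrite /e !divnMDl // !divn_small // !addn0.
have /choice[S hS] k := @pushforward R nat M (e k) (fun m n h => (eI k k m n h).2).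
exists S => k l; have [->|kl] := eqVneq k l.
  by rewrite (isometry_starM) //; case: (hS l).
apply: starM_eq0 => x y; apply: ell2_disjoint_dot => j.
have [[m jm]|h] := pselect (exists m, j = e k m); [right|left].
  case: (hS l) => _ h _; apply: h => n; apply/eqP; rewrite jm => /eI[kl' _].
  by rewrite kl' eqxx in kl.
by case: (hS k) => _ h' _; apply: h' => m; apply/eqP => jm; apply: h; exists m.
Qed.

(** The relations of the Cuntz algebra with two generators. The last one, that the two ranges fill
    the space, is what makes the swindle row surjective. *)
Definition cuntz2 (B : cstarAlgType R) (s0 s1 : B) :=
  [/\ star s0 * s0 = 1, star s1 * s1 = 1, star s0 * s1 = 0 &
      s0 * star s0 + s1 * star s1 = 1].

(** One isometry spreads the coordinates over the even integers, the other over the odd ones. *)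
Lemma cuntz2_exists : exists s0 s1 : bop H, cuntz2 s0 s1.
Proof.
have e0 : injective (fun m => m.*2) by move=> m n; lia.
have e1 : injective (fun m => m.*2.+1) by move=> m n; lia.
have [s0 [a0 b0 n0]] := @pushforward R nat M _ e0.
have [s1 [a1 b1 n1]] := @pushforward R nat M _ e1.
have i0 := isometry_starM n0; have i1 := isometry_starM n1.
have o01 : star s0 * s1 = 0.
  apply: starM_eq0 => x y; apply: ell2_disjoint_dot => j.
  have [jo|je] := boolP (odd j); [left; apply: b0|right; apply: b1] => m; apply/eqP; lia.
exists s0, s1; split=> //; apply: bop_ext => x.
have [y0 h0] := pullback x e0; have [y1 h1] := pullback x e1.
have xE : x = s0 y0 + s1 y1.
  apply: ell2_ext => j /=; have [jo|je] := boolP (odd j).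
    have jE : j = (j./2).*2.+1 by lia.
    by rewrite b0 ?add0r => [|m]; [rewrite jE a1 h1|apply/eqP; lia].
  have jE : j = (j./2).*2 by lia.
  by rewrite b1 ?addr0 => [|m]; [rewrite jE a0 h0|apply/eqP; lia].
have s10 : star s1 * s0 = 0 by rewrite -[LHS]starK starM starK o01 star0.
have E0 : star s0 x = y0.
  rewrite xE bopD; rewrite -[star s0 (s0 y0)]/((star s0 * s0) y0) i0.
  by rewrite -[star s0 (s1 y1)]/((star s0 * s1) y1) o01 addr0.
have E1 : star s1 x = y1.
  rewrite xE bopD; rewrite -[star s1 (s1 y1)]/((star s1 * s1) y1) i1.
  by rewrite -[star s1 (s0 y0)]/((star s1 * s0) y0) s10 add0r.
change (s0 (star s0 x) + s1 (star s1 x) = x).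
by rewrite E0 E1 -xE.
Qed.

End Cuntz.

(** * The decomposition trick *)

Section Swindle.
Variables (R : realType) (B : cstarAlgType R) (s0 s1 : B).
Hypothesis cz : cuntz2 s0 s1.
Implicit Types J K X Y T : B.

Definition isometry J := star J * J = 1.

(* The row [swindleA J, swindleB J] is a unitary from a double copy onto one
   copy: [J] absorbs the new summand and shifts its own infinitely many copies. *)
Definition swindleA J := J * s0.
Definition swindleB J := J * s1 * star J + (1 - J * star J).

Let s00 : star s0 * s0 = 1. Proof. by case: cz. Qed.
Let s11 : star s1 * s1 = 1. Proof. by case: cz. Qed.
Let s01 : star s0 * s1 = 0. Proof. by case: cz. Qed.
Let s10 : star s1 * s0 = 0. Proof. by rewrite -[LHS]starK starM starK s01 star0. Qed.

Let star_proj J : star (1 - J * star J) = 1 - J * star J.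
Proof. by rewrite starB star1 starM starK. Qed.

Let mul_proj J : isometry J -> star J * (1 - J * star J) = 0.
Proof. by move=> JJ; rewrite mulrBr mulr1 mulrA JJ mul1r subrr. Qed.

Let proj_mul J : isometry J -> (1 - J * star J) * J = 0.
Proof. by move=> JJ; rewrite mulrBl mul1r -mulrA JJ mulr1 subrr. Qed.

Lemma swindleAA J : isometry J -> star (swindleA J) * swindleA J = 1.
Proof. by move=> JJ; rewrite starM mulrA -(mulrA (star s0)) JJ mulr1. Qed.

Let star_swindleB J : star (swindleB J) = J * star s1 * star J + (1 - J * star J).
Proof. by rewrite starD star_proj !starM starK mulrA. Qed.

Let proj_proj J : isometry J -> (1 - J * star J) * (1 - J * star J) = 1 - J * star J.
Proof. by move=> JJ; rewrite mulrBr mulr1 mulrA proj_mul // mul0r subr0. Qed.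

Lemma swindleBB J : isometry J -> star (swindleB J) * swindleB J = 1.
Proof.
move=> JJ; rewrite star_swindleB /swindleB.
have := subrK (J * star J) 1.
move: (1 - J * star J) (mul_proj JJ) (proj_mul JJ) (proj_proj JJ) => Q JQ QJ QQ Q1.
rewrite mulrDl !mulrDr QQ -!mulrA JQ !mulr0 addr0 !mulrA QJ !mul0r add0r.
by rewrite -(mulrA _ (star J) J) JJ mulr1 -(mulrA J (star s1)) s11 mulr1 addrC.
Qed.

Lemma swindleAB J : isometry J -> star (swindleA J) * swindleB J = 0.
Proof.
move=> JJ; rewrite starM /swindleB.
move: (1 - J * star J) (mul_proj JJ) => Q JQ.
rewrite mulrDr -!mulrA JQ mulr0 addr0.
by rewrite (mulrA (star J)) JJ mul1r mulrA s01 mul0r.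
Qed.

Lemma swindleBA J : isometry J -> star (swindleB J) * swindleA J = 0.
Proof. by move=> JJ; rewrite -[LHS]starK starM starK swindleAB // star0. Qed.

Lemma swindle_row J : isometry J ->
  swindleA J * star (swindleA J) + swindleB J * star (swindleB J) = 1.
Proof.
move=> JJ; rewrite star_swindleB starM /swindleB /swindleA.
have := subrK (J * star J) 1.
move: (1 - J * star J) (mul_proj JJ) (proj_mul JJ) (proj_proj JJ) => Q JQ QJ QQ Q1.
rewrite mulrDl !mulrDr QQ -!mulrA JQ !mulr0 addr0 !mulrA QJ !mul0r add0r.
rewrite -(mulrA _ (star J) J) JJ mulr1 addrA -!mulrDl -(mulrA J s0) -(mulrA J s1) -mulrDr.
by case: cz => _ _ _ ->; rewrite mulr1 addrC.
Qed.

(** The row of [J] times the adjoint of the row of [K], with the two copies exchanged in between.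
    The exchange pairs each phase-invariant entry [swindleB] with an entry [swindleA] that carries
    the phase. *)
Definition swindle J K :=
  swindleA J * star (swindleB K) + swindleB J * star (swindleA K).

Lemma swindle_unitary J K : isometry J -> isometry K -> unitary (swindle J K).
Proof.
have half X Y : isometry X -> isometry Y -> star (swindle X Y) * swindle X Y = 1.
  move=> XX YY; rewrite /swindle.
  move: (swindleAA XX) (swindleBB XX) (swindleAB XX) (swindleBA XX) (swindle_row YY).
  move: (swindleA X) (swindleB X) (swindleA Y) (swindleB Y) => a b a' b' aa bb ab ba r.
  rewrite starD !starM !starK mulrDl !mulrDr -!mulrA !(mulrA (star a)) !(mulrA (star b)).
  by rewrite aa bb ab ba !mul0r !mulr0 !mul1r addr0 add0r addrC r.
move=> JJ KK; split; first exact: half.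
have -> : swindle J K = star (swindle K J).
  rewrite /swindle; move: (swindleA J) (swindleB J) (swindleA K) (swindleB K) => *.
  by rewrite starD !starM !starK addrC.
by rewrite starK half.
Qed.

Let nle1 X : isometry X -> nrm X <= 1. Proof. exact: nrm_isometry_le. Qed.

Let nrm_mul_le X Y (a b : R) : nrm X <= a -> nrm Y <= b -> nrm (X * Y) <= a * b.
Proof. by move=> Xa Yb; apply: le_trans (nrmM _ _) _; rewrite ler_pM ?nrm_ge0. Qed.

Let conj_dist X Y T e : isometry X -> isometry Y -> nrm T <= 1 -> nrm (X - Y) <= e ->
  nrm (X * T * star X - Y * T * star Y) <= 2 * e.
Proof.
move=> XX YY T1 XY.
have -> : X * T * star X - Y * T * star Y = (X - Y) * T * star X + Y * T * star (X - Y).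
  by rewrite starB mulrBr !mulrBl addrA subrK.
apply: le_trans (nrmD _ _) _.
rewrite mulr_natl mulr2n; apply: lerD.
  rewrite (_ : e = e * 1 * 1); last by rewrite !mulr1.
  by apply: nrm_mul_le; [exact: nrm_mul_le|rewrite nrm_star nle1].
rewrite (_ : e = 1 * 1 * e); last by rewrite !mul1r.
by apply: nrm_mul_le; [apply: nrm_mul_le => //; exact: nle1|rewrite nrm_star].
Qed.

Let swindleA_dist X Y e : nrm (X - Y) <= e -> nrm (swindleA X - swindleA Y) <= e.
Proof.
move=> XY; by rewrite -mulrBl -[leRHS]mulr1 nrm_mul_le ?nle1.
Qed.

Let swindleB_dist X Y e : isometry X -> isometry Y -> nrm (X - Y) <= e ->
  nrm (swindleB X - swindleB Y) <= 4 * e.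
Proof.
move=> XX YY XY.
have -> : swindleB X - swindleB Y = (X * s1 * star X - Y * s1 * star Y) -
    (X * 1 * star X - Y * 1 * star Y).
  rewrite /swindleB !mulr1 opprD addrACA; congr (_ + _).
  by rewrite [RHS]opprB opprD addrACA subrr add0r opprK addrC.
apply: le_trans (nrmD _ _) _; rewrite nrmN.
have := conj_dist XX YY (nle1 s11) XY; have := conj_dist XX YY (nrm1_le B) XY; lra.
Qed.

(** [swindleA] is 1-Lipschitz. [swindleB] is 4-Lipschitz, being a difference of two conjugations by
    the isometry. Each of the two products in [swindle] contributes 1 + 4. *)
Lemma swindle_dist X Y X' Y' e : isometry X -> isometry Y -> isometry X' -> isometry Y' ->
  nrm (X - X') <= e -> nrm (Y - Y') <= e ->
  nrm (swindle X Y - swindle X' Y') <= 10 * e.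
Proof.
have half (P Q P' Q' : B) (a b : R) : nrm P <= 1 -> nrm Q' <= 1 -> nrm (P - P') <= a ->
    nrm (Q - Q') <= b -> nrm Q <= 1 -> nrm P' <= 1 ->
    nrm (P * star Q - P' * star Q') <= a + b.
  move=> P1 Q1 PP QQ Q1' P1'.
  have -> : P * star Q - P' * star Q' = (P - P') * star Q + P' * star (Q - Q').
    by rewrite starB mulrBr mulrBl addrA subrK.
  apply: le_trans (nrmD _ _) _; apply: lerD.
    by rewrite -[leRHS]mulr1 nrm_mul_le ?nrm_star.
  by rewrite -[leRHS]mul1r nrm_mul_le ?nrm_star.
move=> XX YY XX' YY' dX dY.
have nA Z : isometry Z -> nrm (swindleA Z) <= 1 by move=> /swindleAA; exact: nle1.
have nB Z : isometry Z -> nrm (swindleB Z) <= 1 by move=> /swindleBB; exact: nle1.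
rewrite /swindle opprD addrACA; apply: le_trans (nrmD _ _) _.
have h1 := half _ _ _ _ _ _ (nA X XX) (nB Y' YY') (swindleA_dist dX)
  (swindleB_dist YY YY' dY) (nB Y YY) (nA X' XX').
have h2 := half _ _ _ _ _ _ (nB X XX) (nA Y' YY') (swindleB_dist XX XX' dX)
  (swindleA_dist dY) (nA Y YY) (nB X' XX').
by move: (nrm _) (nrm _) h1 h2 => *; lra.
Qed.

Lemma isometryZ J (w : R[i]) : `|w| = 1 -> isometry J -> isometry (w *: J).
Proof.
move=> w1 JJ; rewrite /isometry starZ mulZl mulZr scalerA JJ.
by rewrite mulrC -sqr_normc w1 expr1n scale1r.
Qed.

(** [swindleB] does not see phases; in the first product [w] comes out of [swindleA] of [J], in the
    second out of the adjoint of [swindleA] of [K], which conjugates the scalar. *)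
Lemma swindleZ J K (w : R[i]) : `|w| = 1 ->
  swindle (w *: J) (w^*%C *: K) = w *: swindle J K.
Proof.
move=> w1; have ww : w * w^*%C = 1 by rewrite -sqr_normc w1 expr1n.
have BZ L (a : R[i]) : a * a^*%C = 1 -> swindleB (a *: L) = swindleB L.
  move=> aa; rewrite /swindleB starZ !mulZl !mulZr !scalerA.
  by rewrite ?[a^*%C * a]mulrC aa !scale1r.
rewrite /swindle !BZ ?conjcK // 1?mulrC // /swindleA !mulZl starZ conjcK !mulZr.
by rewrite -scalerDr.
Qed.

End Swindle.

(** * Unit vectors as isometries *)

Section OrthogonalIsometries.
Variables (R : realType) (B : cstarAlgType R) (K : finType) (S : K -> B).
Hypothesis SS : forall k l, star (S k) * S l = (k == l)%:R.

(** The span of the [S k] is a Hilbert space of functions on [K] inside the algebra: unit vectors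
    become isometries, and norm distances are controlled by l2 distances. *)
Lemma star_comb (c : K -> R[i]) :
  star (\sum_k c k *: S k) * (\sum_k c k *: S k) = (\sum_k `|c k| ^+ 2) *: (1 : B).
Proof.
rewrite (big_morph _ (@starD _ B) (star0 B)) mulr_suml scaler_suml.
apply: eq_bigr => k _; rewrite mulr_sumr (bigD1 k) //= big1 ?addr0 => [|l lk].
  by rewrite starZ mulZl mulZr scalerA SS eqxx mulrC -sqr_normc.
by rewrite starZ mulZl mulZr SS eq_sym (negbTE lk) !scaler0.
Qed.

Let sum_normc2 (c : K -> R[i]) :
  \sum_k `|c k| ^+ 2 = (\sum_k complex.Re `|c k| ^+ 2)%:C%C.
Proof.
by rewrite rmorph_sum; apply: eq_bigr => k _; rewrite rmorphXn /=; congr (_ ^+ 2).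
Qed.

Lemma nrm_comb_le (c : K -> R[i]) (e : R) : 0 <= e ->
  \sum_k complex.Re `|c k| ^+ 2 <= e ^+ 2 -> nrm (\sum_k c k *: S k) <= e.
Proof.
move=> e0 h; rewrite -(@ler_pXn2r _ 2) ?nnegrE ?nrm_ge0 // -nrm_starM star_comb.
rewrite sum_normc2 nrmZr ger0_norm ?sumr_ge0 // => [|k _]; last exact: sqr_ge0.
apply: le_trans h; rewrite ler_piMr ?nrm1_le // sumr_ge0 // => k _; exact: sqr_ge0.
Qed.

Lemma isometry_comb (c : K -> R[i]) :
  \sum_k complex.Re `|c k| ^+ 2 = 1 -> isometry (\sum_k c k *: S k).
Proof. by move=> h; rewrite /isometry star_comb sum_normc2 h scale1r. Qed.

End OrthogonalIsometries.

(** * Bumps *)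

Section Phases.
Variable R : realType.
Implicit Types (s t a b : R).

Lemma expiD s t : expi (s + t) = expi s * expi t.
Proof.
apply/eqP; rewrite eq_complex /= cosD sinD eqxx /=.
by rewrite addrC.
Qed.

Lemma expi0 : expi (0 : R) = 1.
Proof. by rewrite /expi cos0 sin0. Qed.

Lemma conj_expi t : (expi t)^*%C = expi (- t).
Proof. by rewrite /expi cosN sinN. Qed.

Lemma Re_normc2 (z : R[i]) : complex.Re `|z| ^+ 2 = complex.Re z ^+ 2 + complex.Im z ^+ 2.
Proof. by rewrite normc_def /= sqr_sqrtr // addr_ge0 ?sqr_ge0 //; case: z. Qed.

Lemma norm_expi t : `|expi t| = 1.
Proof. by rewrite normc_def /= cos2Dsin2 sqrtr1. Qed.

Lemma Re_norm_expiM t (z : R[i]) : complex.Re `|expi t * z| = complex.Re `|z|.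
Proof. by rewrite normrM norm_expi mul1r. Qed.

Lemma Re_norm_real_expi a t : complex.Re `|a%:C%C * expi t| ^+ 2 = a ^+ 2.
Proof. by rewrite mulrC Re_norm_expiM Re_normc2 /= expr0n addr0. Qed.

Lemma sin_sqr_le t : sin t ^+ 2 <= t ^+ 2.
Proof.
wlog t0 : t / 0 <= t => [h|].
  have [/h//|/ltW] := leP 0 t; rewrite -oppr_ge0 => /h.
  by rewrite sinN !sqrrN.
have [|c _] := @MVT_segment R sin cos 0 t t0 (fun x _ => is_derive_sin x).
  exact/continuous_subspaceT/continuous_sin.
by rewrite sin0 !subr0 => ->; rewrite exprMn ler_piMl ?sqr_ge0 //.
Qed.

Lemma cos_ge_quadratic t : 1 - cos t <= t ^+ 2 / 2.
Proof.
have := sin_sqr_le (t / 2); have := cos2Dsin2 (t / 2).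
have -> : cos t = 2 * cos (t / 2) ^+ 2 - 1.
  have e : (t / 2) *+ 2 = t by rewrite -mulr_natr divfK.
  by rewrite -{1}e cos_mulr2n mulr_natl.
by rewrite expr_div_n; move: (t ^+ 2) => s; lra.
Qed.

(** The square equals (a - b)^2 + 2 a b (1 - cos t), with 1 - cos t <= t^2 / 2. The cross term is
    rearranged so that t^2 carries the weight b^2 alone: [b] will be the bump at the very point
    where [t] is evaluated, and a second moment appears. *)
Lemma phase_dist_le a b t :
  complex.Re `|a%:C%C * expi t - b%:C%C| ^+ 2 <= 2 * (a - b) ^+ 2 + 2 * (b ^+ 2 * t ^+ 2).
Proof.
rewrite Re_normc2 /=.
have h0 := cos2Dsin2 t; have h1 := cos_ge_quadratic t.
have h2 := cos_le1 t; have h3 := cos_geN1 t.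
rewrite !(mul0r, mulr0, subr0, addr0, oppr0).
have -> : (a * cos t - b) ^+ 2 + (a * sin t) ^+ 2 =
    (a - b) ^+ 2 + 2 * (a * b) * (1 - cos t).
  have -> : (a * sin t) ^+ 2 = a ^+ 2 * (1 - cos t ^+ 2) by rewrite -h0; ring.
  ring.
move: h1 h2 h3; move: (cos t) => c h1 h2 h3.
have h4 : 2 * ((a - b) * (b * (1 - c))) <= (a - b) ^+ 2 + (b * (1 - c)) ^+ 2.
  by have := sqr_ge0 ((a - b) - b * (1 - c)); lra.
have h5 : b ^+ 2 * (1 - c) ^+ 2 <= b ^+ 2 * (2 * (1 - c)).
  by rewrite ler_wpM2l ?sqr_ge0 //; nra.
have h6 : b ^+ 2 * (4 * (1 - c)) <= b ^+ 2 * (2 * t ^+ 2).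
  by rewrite ler_wpM2l ?sqr_ge0 //; lra.
have -> : 2 * (a * b) * (1 - c) = 2 * ((a - b) * (b * (1 - c))) + b ^+ 2 * (2 * (1 - c)).
  ring.
by move: h4 h5 h6; rewrite exprMn; lra.
Qed.

End Phases.

(** * Moments of product weights *)

Section ProductMoments.
Variables (R : realFieldType) (d : nat) (T : finType) (p : T -> R).
Hypothesis p1 : \sum_a p a = 1.
Implicit Types (F : 'I_d -> T -> R).

Lemma sum_ffun_prod F :
  \sum_(h : {ffun 'I_d -> T}) \prod_i F i (h i) = \prod_i \sum_a F i a.
Proof. by rewrite bigA_distr_bigA. Qed.

Lemma sum_ffun_prod1 (G : T -> R) l :
  \sum_(h : {ffun 'I_d -> T}) \prod_i (if i == l then G (h i) else p (h i)) = \sum_a G a.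
Proof.
rewrite (sum_ffun_prod (fun i a => if i == l then G a else p a)).
rewrite (bigD1 l) //= eqxx [X in _ * X]big1 ?mulr1 // => i /negbTE->; exact: p1.
Qed.

(** Mixed moments factor over the coordinates and vanish because [x] has mean zero; this is the
    variance of a sum of independent variables. *)
Lemma second_moment (x : T -> R) (V : R) (c : 'I_d -> R) :
  \sum_a p a * x a = 0 -> \sum_a p a * x a ^+ 2 <= V ->
  \sum_(h : {ffun 'I_d -> T}) (\prod_i p (h i)) * (\sum_j c j * x (h j)) ^+ 2 <=
  V * \sum_j c j ^+ 2.
Proof.
move=> m0 mV.
have pair j k : \sum_(h : {ffun 'I_d -> T}) (\prod_i p (h i)) * (x (h j) * x (h k)) =
    if j == k then \sum_a p a * x a ^+ 2 else 0.
  pose F i a := p a * ((if i == j then x a else 1) * (if i == k then x a else 1)).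
  transitivity (\sum_(h : {ffun 'I_d -> T}) \prod_i F i (h i)).
    apply: eq_bigr => h _; rewrite !big_split /= -!big_mkcond /=.
    by rewrite !big_pred1_eq.
  rewrite sum_ffun_prod; case: eqP => [?|/eqP jk]; first subst k.
    rewrite (bigD1 j) //= [X in _ * X]big1 ?mulr1 => [|i /negbTE ij].
      by apply: eq_bigr => a _; rewrite /F eqxx expr2.
    by rewrite -p1; apply: eq_bigr => a _; rewrite /F ij !mulr1.
  rewrite (bigD1 j) //= (_ : \sum_a F j a = 0) ?mul0r //.
  by apply: etrans m0; apply: eq_bigr => a _; rewrite /F eqxx (negbTE jk) mulr1.
have -> : \sum_(h : {ffun 'I_d -> T}) (\prod_i p (h i)) * (\sum_j c j * x (h j)) ^+ 2 =
    \sum_j \sum_k c j * c k * (if j == k then \sum_a p a * x a ^+ 2 else 0).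
  rewrite (eq_bigr (fun h : {ffun 'I_d -> T} => \sum_j \sum_k
      c j * c k * ((\prod_i p (h i)) * (x (h j) * x (h k))))); last first.
    move=> h _; rewrite expr2 mulr_suml mulr_sumr; apply: eq_bigr => j _.
    rewrite mulr_sumr mulr_sumr; apply: eq_bigr => k _; ring.
  rewrite exchange_big /=; apply: eq_bigr => j _.
  rewrite exchange_big /=; apply: eq_bigr => k _.
  by rewrite -mulr_sumr pair.
rewrite mulr_sumr; apply: ler_sum => j _.
rewrite (bigD1 j) //= eqxx [X in _ + X]big1 ?addr0 => [|k /negbTE kj].
  by rewrite -expr2 mulrC ler_wpM2r ?sqr_ge0.
by rewrite eq_sym kj mulr0.
Qed.

End ProductMoments.

Section Triangle.
Variables (R : realType) (n : nat).
Local Notation N := (n.+1).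
Local Notation T := 'I_(n.*2.+2).
Local Notation Nr := (n.+1%:R : R).

(* [tri] is a triangular bump on the cyclic group of order [2 N], centred at [N];
   it vanishes at [0], where the centred coordinate [ctr] jumps. *)
Definition ctr (a : T) : R := (a : nat)%:R - Nr.
Definition tri (a : T) : R := Nr - `|ctr a|.
Definition tri_mass : R := \sum_a tri a ^+ 2.

Let valS (a : T) : nat_of_ord (a + 1)%R = (a.+1 %% n.*2.+2)%N.
Proof. by rewrite -[in RHS]addn1 -[RHS]modnDmr. Qed.

Let ctrE (a : T) : exists2 s : bool,
  tri a = (if s then (a : nat)%:R else 2 * Nr - (a : nat)%:R) & (s = (a <= N)%N).
Proof.
exists (a <= N)%N => //; rewrite /tri /ctr; case: leqP => aN.
  rewrite ler0_norm ?subr_le0 ?ler_nat //; ring.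
rewrite ger0_norm ?subr_ge0 ?ler_nat 1?ltnW //; ring.
Qed.

(** The coordinate jumps only from 2 N - 1 to 0, and there the bump vanishes. *)
Lemma ctr_succ (a : T) : tri (a + 1) != 0 -> ctr (a + 1) = ctr a + 1.
Proof.
have := ltn_ord a; have v := valS a.
have [ap|] := boolP (a.+1 < n.*2.+2)%N.
  by move=> _ _; rewrite /ctr v modn_small // -natr1; ring.
move=> h1 h2; have a1 : (a : nat).+1 = n.*2.+2 by lia.
by rewrite /tri /ctr v a1 modnn sub0r normrN ger0_norm // subrr eqxx.
Qed.

Lemma tri0 : tri 0 = 0.
Proof. by rewrite /tri /ctr sub0r normrN ger0_norm // subrr. Qed.

Lemma ctr_le (a : T) : ctr a ^+ 2 <= Nr ^+ 2.
Proof.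
rewrite -real_normK ?num_real // lerXn2r ?nnegrE //.
rewrite ler_norml /ctr; have : (0 : R) <= (a : nat)%:R by [].
have : (a : nat)%:R <= 2 * Nr.
  by rewrite -natrM ler_nat; have := ltn_ord a; lia.
lra.
Qed.

Lemma tri_step (a : T) : (tri (a + 1) - tri a) ^+ 2 <= 1.
Proof.
have [z|nz] := eqVneq (tri (a + 1)) 0; last first.
  rewrite /tri (ctr_succ nz); rewrite -[leRHS](expr1n _ 2) -real_normK ?num_real //.
  have h1 := ler_normD (ctr a) 1; have h2 := ler_normD (ctr a + 1) (- 1).
  rewrite addrK normrN normr1 in h2; rewrite normr1 in h1.
  rewrite lerXn2r ?nnegrE // ler_norml; move: h1 h2.
  by move: (`|ctr a|) (`|ctr a + 1|) => r s *; apply/andP; split; lra.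
(* A zero of the bump forces a + 1 = 0 in the cyclic group, so a = 2 N - 1, where the bump is 1. For
   N = 1 this point is the centre, whence the two cases below. *)
rewrite z sub0r sqrrN.
have [s tE sE] := ctrE (a + 1); have [s' tE' sE'] := ctrE a.
have v := valS a; have al := ltn_ord a.
have [ap|ap] := boolP (a.+1 < n.*2.+2)%N.
  rewrite modn_small // in v.
  move: tE; rewrite z v; case: ifP => _.
    by move/esym/eqP; rewrite pnatr_eq0.
  move/esym/eqP; rewrite subr_eq0 -natrM eqr_nat => /eqP h.
  by exfalso; lia.
have a1 : (a : nat).+1 = n.*2.+2 by lia.
rewrite tE' sE'; case: leqP => aN.
  by rewrite (_ : (a : nat) = 1%N) ?expr1n //; lia.
have -> : (a : nat)%:R = 2 * Nr - 1 :> R.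
  by apply/eqP; rewrite -subr_eq0 opprB addrA natr1 a1 -natrM subr_eq0 eqr_nat; apply/eqP; lia.
by rewrite opprB addrCA subrr addr0 expr1n.
Qed.

Lemma tri_step_sum : \sum_a (tri (a + 1) - tri a) ^+ 2 <= 2 * Nr.
Proof.
apply: le_trans (ler_sum _ (fun a _ => tri_step a)) _.
by rewrite sumr_const card_ord -natrM ler_nat; lia.
Qed.

(** The reflection a -> - a preserves the bump and negates the centred coordinate, except at 0,
    where the weight is zero. *)
Lemma tri_mean : \sum_a tri a ^+ 2 * ctr a = 0.
Proof.
have h : \sum_a tri a ^+ 2 * ctr a = - \sum_a tri a ^+ 2 * ctr a.
  rewrite {1}(reindex_inj (@oppr_inj T)) /= -sumrN; apply: eq_bigr => a _.
  have [->|a0] := eqVneq a 0; first by rewrite oppr0 tri0 expr0n !mul0r oppr0.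
  have v : nat_of_ord (- a)%R = ((n.*2.+2 - a) %% n.*2.+2)%N by [].
  have ap : (0 < a)%N by rewrite lt0n.
  rewrite modn_small in v; last by have := ltn_ord a; lia.
  have c : ctr (- a) = - ctr a.
    rewrite /ctr v natrB ?(ltnW (ltn_ord a)) //.
    have -> : (n.*2.+2)%:R = 2 * Nr :> R by rewrite -natrM; congr (_%:R); lia.
    ring.
  by rewrite /tri c normrN mulrN.
lra.
Qed.

(** The values at a and a + N add up to N, so their squares add up to at least N^2 / 2. Summing over
    2 N points counts the mass twice. *)
Lemma tri_mass_ge : Nr ^+ 3 / 2 <= tri_mass.
Proof.
pose k : T := inord N.
have kv : nat_of_ord k = N by rewrite inordK //; lia.
have h (a : T) : tri a + tri (a + k) = Nr.
  have v : nat_of_ord (a + k)%R = ((a + k) %% n.*2.+2)%N by [].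
  rewrite kv in v; have al := ltn_ord a.
  have [s tE sE] := ctrE (a + k); have [s' tE' sE'] := ctrE a.
  rewrite tE tE' {tE tE'} sE sE' {s sE s' sE'}.
  have [aN|aN] := ltnP a N.
    rewrite modn_small in v; last by lia.
    rewrite v (ltnW aN); case: leqP => h; rewrite natrD; last by ring.
    have -> : (a : nat) = 0%N by lia.
    by rewrite addrC; ring.
  have {}v : nat_of_ord (a + k)%R = (a - N)%N.
    by rewrite v (_ : a + N = a - N + n.*2.+2)%N; [rewrite modnDr modn_small //; lia|lia].
  rewrite v natrB // (_ : (a - N <= N)%N); last by lia.
  case: leqP => h; last by ring.
  have -> : (a : nat) = N by lia.
  ring.
have m2 : 2 * tri_mass = \sum_a (tri a ^+ 2 + tri (a + k) ^+ 2).
  rewrite big_split /= mulr_natl mulr2n; congr (_ + _).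
  by rewrite /tri_mass (reindex_inj (addIr k)).
have : \sum_(a : T) Nr ^+ 2 / 2 <= 2 * tri_mass.
  rewrite m2; apply: ler_sum => a _; rewrite -(h a).
  by have := sqr_ge0 (tri a - tri (a + k)); lra.
rewrite sumr_const card_ord -[_ *+ _]mulr_natl.
have -> : (n.*2.+2)%:R = 2 * Nr :> R by rewrite -natrM; congr (_%:R); lia.
by rewrite exprS; lra.
Qed.

End Triangle.

Section BumpField.
Variables (R : realType) (d n : nat) (B : cstarAlgType R).
Local Notation T := 'I_(n.*2.+2).
Local Notation K := {ffun 'I_d -> T}.
Variable S : K -> B.
Hypothesis SS : forall k l, star (S k) * S l = (k == l)%:R.
Variable D : 'M[R]_d.
Hypothesis Danti : D^T = - D.
Local Notation Nr := (n.+1%:R : R).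

(** The exponent of chi_l, in symmetric gauge. The same formula gives the phases of the twisted
    shifts; since it is linear in the matrix, passing from Theta to Theta' adds the exponent of the
    difference. *)
Definition row_phase (l : 'I_d) (g : 'rV[int]_d) : R := 2^-1 * \sum_j (g 0 j)%:~R * D j l.

Let Dkj j k : D k j = - D j k.
Proof. by have /matrixP/(_ j k) := Danti; rewrite !mxE. Qed.

Let psi (a : T) : R := tri R a / Num.sqrt (tri_mass R n).
Let xi (h : K) : R := \prod_i psi (h i).
Let theta (h : K) (g : 'rV[int]_d) : R := \sum_j \sum_k ctr R (h j) * D j k * (g 0 k)%:~R.
Let bar (g : 'rV[int]_d) : K := [ffun i => (g 0 i)%:~R].
(** A magnetic translate of the unit bump [xi]. On the finite group, translation by [g] permutes the
    indices, so all translates use the same finitely many [S k] and have mass 1. The phase is half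
    the form [D] between the centred position and [g]. *)
Let coef g (k : K) : R[i] := (xi (k + bar g))%:C%C * expi (- (2^-1 * theta (k + bar g) g)).
Definition bump_isometry g : B := \sum_k coef g k *: S k.

Let mass_gt0 : 0 < tri_mass R n.
Proof. by apply: lt_le_trans (tri_mass_ge R n); rewrite divr_gt0 ?exprn_gt0. Qed.

Let sqrt_mass : Num.sqrt (tri_mass R n) ^+ 2 = tri_mass R n.
Proof. by rewrite sqr_sqrtr // ltW. Qed.

Let psi2 a : psi a ^+ 2 = tri R a ^+ 2 / tri_mass R n.
Proof. by rewrite expr_div_n sqrt_mass. Qed.

Let psi_mass : \sum_a psi a ^+ 2 = 1.
Proof.
rewrite (eq_bigr _ (fun a _ => psi2 a)) -mulr_suml divff //.
by rewrite gt_eqF.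
Qed.

Let xi2 h : xi h ^+ 2 = \prod_i psi (h i) ^+ 2.
Proof. by rewrite prodrXl. Qed.

Let xi_mass : \sum_(h : K) xi h ^+ 2 = 1.
Proof.
rewrite (eq_bigr _ (fun h _ => xi2 h)).
rewrite (sum_ffun_prod (fun (i : 'I_d) a => psi a ^+ 2)).
by rewrite big1 // => i _; exact: psi_mass.
Qed.

Lemma bump_isometryP g : isometry (bump_isometry g).
Proof.
apply: isometry_comb => //; rewrite -[RHS]xi_mass.
rewrite [RHS](reindex_inj (addIr (bar g))) /=; apply: eq_bigr => k _.
exact: Re_norm_real_expi.
Qed.

Let bump_step l : K := [ffun i => (i == l)%:R].

Let bar_step g l : bar (g + delta_mx 0 l) = bar g + bump_step l.
Proof.
apply/ffunP => i; rewrite !ffunE !mxE eqxx /= rmorphD /=; congr (_ + _).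
by case: eqP.
Qed.

Let row (l : 'I_d) (h : K) : R := \sum_j D j l * ctr R (h j).

(** Bilinear expansion of [theta] when both arguments move by the [l]-th basis vector. Antisymmetry
    kills the doubly shifted term and gives the sign of the last sum, which is twice [row_phase];
    the hypothesis excludes the jump of [ctr]. *)
Let theta_step g l h : xi (h + bump_step l) != 0 ->
  theta (h + bump_step l) (g + delta_mx 0 l) =
  theta h g + row l h - \sum_j (g 0 j)%:~R * D j l.
Proof.
rewrite /xi => /prodf_neq0 nz.
have ctrS j : ctr R ((h + bump_step l) j) = ctr R (h j) + (j == l)%:R.
  rewrite !ffunE; case: eqP => [->|_]; last by rewrite !addr0.
  apply: ctr_succ; have := nz l isT; rewrite !ffunE eqxx /psi.
  by apply: contraNneq => ->; rewrite mul0r.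
have gS k : ((g + delta_mx 0 l) 0 k)%:~R = (g 0 k)%:~R + (k == l)%:R :> R.
  by rewrite !mxE eqxx /= rmorphD /=; case: eqP.
rewrite /theta.
transitivity (\sum_j \sum_k (ctr R (h j) * D j k * (g 0 k)%:~R +
   (k == l)%:R * (D j k * ctr R (h j)) + (j == l)%:R * (D j k * ((g 0 k)%:~R + (k == l)%:R)))).
  by apply: eq_bigr => j _; apply: eq_bigr => k _; rewrite ctrS gS; ring.
rewrite (eq_bigr _ (fun j _ => big_split _ _ _ _ _)) /= big_split /=; congr (_ + _).
  rewrite (eq_bigr _ (fun j _ => big_split _ _ _ _ _)) /= big_split /=; congr (_ + _).
  apply: eq_bigr => j _; rewrite (bigD1 l) //= eqxx mul1r big1 ?addr0 // => k /negbTE->.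
  by rewrite mul0r.
rewrite (bigD1 l) //= [X in _ + X]big1 ?addr0 => [|j /negbTE jl]; last first.
  by rewrite big1 // => k _; rewrite jl mul0r.
rewrite -sumrN; apply: eq_bigr => k _; rewrite eqxx mul1r Dkj.
case: eqP => [->|_]; last by rewrite addr0; ring.
have : D l l = 0 by have := Dkj l l; lra.
by move=> ->; rewrite oppr0 !mul0r mulr0 oppr0.
Qed.

(** [row_phase] compensates exactly the part of the phase that grows with [g]. Up to a unimodular
    factor the defect depends on h = k + bar g only, hence the final bound is uniform in [g]. *)
Let coef_step g l k (h := k + bar g) :
  coef (g + delta_mx 0 l) k - expi (row_phase l g) * coef g k =
  expi (row_phase l g - 2^-1 * theta h g) *
  ((xi (h + bump_step l))%:C%C * expi (- (2^-1 * row l h)) - (xi h)%:C%C).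
Proof.
rewrite /coef bar_step addrA -/h mulrBr; congr (_ - _); last first.
  by rewrite mulrCA -expiD mulrC.
have [->|nz] := eqVneq (xi (h + bump_step l)) 0; first by rewrite !mul0r mulr0.
rewrite theta_step // [RHS]mulrCA -expiD; congr (_ * expi _).
by rewrite /row_phase; ring.
Qed.

(** Factors other than the [l]-th sum to 1. What remains is one dimensional: at most 2 N for the
    slopes, divided by a mass of at least N^3 / 2. *)
Let step_sum l : \sum_(h : K) (xi (h + bump_step l) - xi h) ^+ 2 <= 4 / Nr ^+ 2.
Proof.
have -> : \sum_(h : K) (xi (h + bump_step l) - xi h) ^+ 2 = \sum_a (psi (a + 1) - psi a) ^+ 2.
  rewrite -(sum_ffun_prod1 psi_mass (fun a => (psi (a + 1) - psi a) ^+ 2) l).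
  apply: eq_bigr => h _; rewrite /xi (bigD1 l) //= [\prod_i psi (h i)](bigD1 l) //=.
  rewrite [RHS](bigD1 l) //= eqxx !ffunE eqxx.
  rewrite (eq_bigr (fun i => psi (h i))) => [|i /negbTE il]; last first.
    by rewrite !ffunE il addr0.
  rewrite -mulrBl exprMn -prodrXl; congr (_ * _).
  by apply: eq_bigr => i /negbTE ->.
have -> : \sum_a (psi (a + 1) - psi a) ^+ 2 =
    (\sum_(a : T) (tri R (a + 1) - tri R a) ^+ 2) / tri_mass R n.
  rewrite mulr_suml; apply: eq_bigr => a _.
  by rewrite /psi -mulrBl expr_div_n sqrt_mass.
rewrite ler_pdivrMr //; apply: le_trans (tri_step_sum R n) _.
have key (x : R) : x != 0 -> 2 * x = 4 / x ^+ 2 * (x ^+ 3 / 2) by move=> ?; field.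
rewrite key ?pnatr_eq0 //.
by rewrite ler_wpM2l ?divr_ge0 ?exprn_ge0 // tri_mass_ge.
Qed.

Let row_sum l : \sum_(h : K) xi h ^+ 2 * row l h ^+ 2 <= Nr ^+ 2 * \sum_j D j l ^+ 2.
Proof.
rewrite (eq_bigr (fun h : K => (\prod_i psi (h i) ^+ 2) * row l h ^+ 2)) => [|h _]; last first.
  by rewrite xi2.
apply: (second_moment psi_mass (x := ctr R (n := n)) (V := Nr ^+ 2)).
  rewrite (eq_bigr (fun a => (tri_mass R n)^-1 * (tri R a ^+ 2 * ctr R a))) => [|a _].
    by rewrite -mulr_sumr tri_mean mulr0.
  by rewrite psi2; ring.
have -> : Nr ^+ 2 = \sum_a Nr ^+ 2 * psi a ^+ 2 by rewrite -mulr_sumr psi_mass mulr1.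
apply: ler_sum => a _.
by rewrite [leRHS]mulrC; apply: ler_wpM2l; [exact: sqr_ge0|exact: ctr_le].
Qed.

(** From [phase_dist_le]: 8 is twice the 4 of [step_sum], and the factor 1/2 on the column is 2
    (1/2)^2, as the remaining phase is half of [row]. *)
Lemma bump_isometry_dist g l (e : R) : 0 <= e ->
  8 / Nr ^+ 2 + Nr ^+ 2 * (\sum_j D j l ^+ 2) / 2 <= e ^+ 2 ->
  nrm (bump_isometry (g + delta_mx 0 l) - expi (row_phase l g) *: bump_isometry g) <= e.
Proof.
move=> e0 he; rewrite /bump_isometry scaler_sumr -sumrB.
rewrite (eq_bigr (fun k => (coef (g + delta_mx 0 l) k - expi (row_phase l g) * coef g k) *: S k)); last first.
  by move=> k _; rewrite scalerBl scalerA.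
apply: nrm_comb_le => //; apply: le_trans he.
apply: (@le_trans _ _ (\sum_(h : K) (2 * (xi (h + bump_step l) - xi h) ^+ 2 +
    2^-1 * (xi h ^+ 2 * row l h ^+ 2)))).
  rewrite [leRHS](reindex_inj (addIr (bar g))); apply: ler_sum => k _.
  have E := coef_step g l k; cbv zeta in E.
  rewrite [X in complex.Re `|X|]E Re_norm_expiM; apply: le_trans (phase_dist_le _ _ _) _.
  by rewrite le_eqVlt; apply/orP; left; apply/eqP; field.
rewrite big_split /= -!mulr_sumr.
have h2 : (0 : R) <= 2 by []; have h3 : (0 : R) <= 2^-1 by rewrite invr_ge0.
apply: le_trans (lerD (ler_wpM2l h2 (step_sum l)) (ler_wpM2l h3 (row_sum l))) _.
move: (\sum_j _) (Nr ^+ 2) => s t; lra.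
Qed.

End BumpField.

(** * Twisted shifts and the theorem *)

Section PhaseField.
Variables (R : realType) (d : nat).
Local Notation M := (ell2 nat (cplane R)).

Lemma row_phaseN (D : 'M[R]_d) l g : row_phase (- D) l g = - row_phase D l g.
Proof.
rewrite /row_phase -mulrN -sumrN; congr (_ * _).
by apply: eq_bigr => j _; rewrite mxE mulrN.
Qed.

Lemma phase_field (D : 'M[R]_d) (rho : R) : D^T = - D -> 0 <= rho ->
  (forall l, \sum_j D j l ^+ 2 <= rho ^+ 2) ->
  exists W : 'rV[int]_d -> bop M, (forall g, unitary (W g)) /\
    forall g l, nrm (W (g + delta_mx 0 l) - expi (row_phase D l g) *: W g) <=
      28 * Num.sqrt rho.
Proof.
move=> Da rho0 Dl.
have [rz|rn] := eqVneq rho 0.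
  exists (fun=> 1); split=> [g|g l]; first exact: unitary1.
  have -> : row_phase D l g = 0.
    rewrite /row_phase big1 ?mulr0 // => j _.
    have : D j l ^+ 2 <= 0.
      apply: le_trans (_ : \sum_i D i l ^+ 2 <= 0); last by have := Dl l; rewrite rz expr0n.
      by rewrite (bigD1 j) //= lerDl sumr_ge0 // => i _; exact: sqr_ge0.
    by rewrite le_eqVlt ltNge sqr_ge0 orbF sqrf_eq0 => /eqP->; rewrite mulr0.
  by rewrite expi0 scale1r subrr nrm0 rz sqrtr0 mulr0.
pose r := Num.sqrt rho; have rr : r ^+ 2 = rho by rewrite sqr_sqrtr.
have r0 : 0 < r by rewrite sqrtr_gt0 lt_neqAle eq_sym rn.
(* For r >= 1 the trivial distance 2 suffices; r < 1 is used below to bound N r from above. *)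
have [r1|r1] := leP 1 r.
  exists (fun=> 1); split=> [g|g l]; first exact: unitary1.
  apply: le_trans (nrmD _ _) _; rewrite nrmN nrmZ norm_expi mul1r.
  by have := nrm1_le (bop M); rewrite -/r; move: (nrm _) => *; lra.
(* N is the first integer above 3 / (2 r), so 3/2 < N r <= 3/2 + r <= 5/2. *)
pose n := Num.truncn (3 / 2 / r); pose N : R := n.+1%:R.
have N1 : 3 / 2 < N * r by rewrite -ltr_pdivrMr //; exact: truncnS_gt.
have N2 : N * r <= 5 / 2.
  have : n%:R <= 3 / 2 / r by rewrite truncn_le !divr_ge0 // ltW.
  by rewrite ler_pdivlMr // /N -natr1 mulrDl mul1r; lra.
have N0 : 0 < N by rewrite ltr0n.
(* The two error terms are at most (32/9) r^2 and (25/8) r^2, and 32/9 + 25/8 < 196/25 =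
   (14/5)^2. *)
pose e := 14 / 5 * r; have e0 : 0 <= e by rewrite mulr_ge0 ?divr_ge0 // ltW.
have he l : 8 / N ^+ 2 + N ^+ 2 * (\sum_j D j l ^+ 2) / 2 <= e ^+ 2.
  have h1 : 8 / N ^+ 2 <= 32 / 9 * r ^+ 2.
    rewrite ler_pdivrMr ?exprn_gt0 //.
    have : (3 / 2) ^+ 2 <= (N * r) ^+ 2.
      by apply: lerXn2r; rewrite ?nnegrE ?mulr_ge0 ?divr_ge0 ?(ltW r0) ?(ltW N1).
    by rewrite exprMn; lra.
  have h2 : N ^+ 2 * (\sum_j D j l ^+ 2) <= 25 / 4 * r ^+ 2.
    apply: le_trans (ler_wpM2l (sqr_ge0 N) (Dl l)) _; rewrite -rr.
    rewrite (_ : N ^+ 2 * (r ^+ 2) ^+ 2 = (N * r) ^+ 2 * r ^+ 2); last by ring.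
    rewrite ler_wpM2r ?sqr_ge0 //.
    apply: (@le_trans _ _ ((5 / 2) ^+ 2)); last by lra.
    by apply: lerXn2r; rewrite ?nnegrE ?mulr_ge0 ?divr_ge0 ?(ltW r0).
  have r20 := sqr_ge0 r.
  have -> : e ^+ 2 = 196 / 25 * r ^+ 2 by rewrite /e; field.
  move: h1 h2 r20; move: (8 / _) (N ^+ 2 * _) (r ^+ 2) => *; lra.
have [S SS] := orthogonal_isometries (cplane R) {ffun 'I_d -> 'I_(n.*2.+2)}.
have [s0 [s1 cz]] := cuntz2_exists (cplane R).
have DaN : (- D)^T = - (- D) by apply/matrixP => i j; have /matrixP/(_ i j) := Da; rewrite !mxE => ->.
have heN l : 8 / N ^+ 2 + N ^+ 2 * (\sum_j (- D) j l ^+ 2) / 2 <= e ^+ 2.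
  rewrite (eq_bigr (fun j => D j l ^+ 2)) => [|j _]; first exact: he.
  by rewrite mxE sqrrN.
have JI := bump_isometryP SS D; have JI' := bump_isometryP SS (- D).
exists (fun g => swindle s0 s1 (bump_isometry S D g) (bump_isometry S (- D) g)).
split=> [g|g l]; first exact: swindle_unitary.
(* The phase of the unitary is split into a phase on the bump for [D] and its conjugate on the bump
   for [- D], each of which that bump follows up to [e]. *)
rewrite -swindleZ ?norm_expi // (_ : 28 * _ = 10 * e); last by rewrite /e -/r; field.
apply: swindle_dist => //.
- by apply: isometryZ; rewrite ?norm_expi.
- by apply: isometryZ => //; rewrite conj_expi norm_expi.
- exact: bump_isometry_dist.
- by rewrite conj_expi -row_phaseN; exact: bump_isometry_dist.
Qed.

End PhaseField.

Lemma bij_addr (V : zmodType) (a : V) : bijective (fun x => x + a).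
Proof. by exists (fun x => x - a) => x; rewrite ?addrK ?subrK. Qed.

Section TwistedShifts.
Variables (R : realType) (d : nat) (M : hilbertType R).
Local Notation I := 'rV[int]_d.
Local Notation H := (ell2 I M).
Local Notation e_ l := (delta_mx 0 l : I).

Let nrm1 (t : R) : nrm (expi t *: (1 : bop M)) <= 1.
Proof. by rewrite nrmZ norm_expi mul1r nrm1_le. Qed.

Variable Theta : 'M[R]_d.
Hypothesis Tanti : Theta^T = - Theta.

Definition twisted_shift l : bop H :=
  wshift (fun i => nrm1 (row_phase Theta l (i - e_ l))) (bij_addr (- e_ l)).

Let back l : bop H := wshift (fun i => nrm1 (- row_phase Theta l i)) (bij_addr (e_ l)).

Lemma twisted_shiftE l (x : H) i :
  twisted_shift l x i = expi (row_phase Theta l (i - e_ l)) *: x (i - e_ l).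
Proof. by []. Qed.

Let backE l (x : H) i : back l x i = expi (- row_phase Theta l i) *: x (i + e_ l).
Proof. by []. Qed.

Let shift_back l : twisted_shift l * back l = 1.
Proof.
apply: bop_ext => x; apply: ell2_ext => i; change (twisted_shift l (back l x) i = x i).
by rewrite twisted_shiftE backE scalerA -expiD subrr expi0 scale1r subrK.
Qed.

Let nrm_expi t (x : M) : nrm (expi t *: x) = nrm x.
Proof. by rewrite nrmZ norm_expi mul1r. Qed.

Let shift_iso l (x : H) : nrm (twisted_shift l x) = nrm x.
Proof.
apply: (ell2_isometry (bij_addr (- e_ l))) => i.
by rewrite twisted_shiftE nrm_expi.
Qed.

Lemma twisted_shift_star l (x : H) i :
  star (twisted_shift l) x i = expi (- row_phase Theta l i) *: x (i + e_ l).
Proof. by rewrite (isometry_inv_star (shift_iso l) (shift_back l)) backE. Qed.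

Let row_phaseB k l i : row_phase Theta l (i - e_ k) = row_phase Theta l i - 2^-1 * Theta k l.
Proof.
rewrite /row_phase -mulrBr; congr (_ * _).
have -> : Theta k l = \sum_j (j == k)%:R * Theta j l.
  by rewrite (bigD1 k) //= eqxx mul1r big1 ?addr0 // => j /negbTE->; rewrite mul0r.
rewrite -sumrB; apply: eq_bigr => j _.
by rewrite !mxE eqxx /= rmorphB /= mulrBl; case: eqP.
Qed.

(** Exchanging two steps changes the phase by (Theta_kl - Theta_lk) / 2, which is Theta_kl by
    antisymmetry. *)
Lemma twisted_shift_rel : unitary_rel Theta twisted_shift.
Proof.
split=> [l|k l]; first exact: surj_isometry_unitary (shift_iso l) (shift_back l).
apply: bop_ext => x; apply: ell2_ext => i.
change (twisted_shift l (twisted_shift k x) i =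
  expi (Theta k l) *: twisted_shift k (twisted_shift l x) i).
rewrite !twisted_shiftE !scalerA -!expiD addrAC; congr (expi _ *: _).
by rewrite !row_phaseB; have /matrixP/(_ k l) := Tanti; rewrite !mxE => ->; field.
Qed.

End TwistedShifts.

Section Graded.
Variables (R : realType) (I : choiceType) (M : hilbertType R).
Local Notation H := (ell2 I M).

Definition at_index (g : I) : set H := [set x | forall i, i != g -> x i = 0].

Lemma at_index_orth g h (x y : H) : g != h -> at_index g x -> at_index h y -> dot x y = 0.
Proof.
move=> gh xg yh; apply: ell2_disjoint_dot => i.
have [ig|ig] := eqVneq i g; [right; apply: yh; rewrite ig //|left; exact: xg].
Qed.

Lemma at_index_vector (g : I) (v : M) : exists2 x : H, at_index g x & nrm x = nrm v.
Proof.
pose f i := if i == g then v else 0.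
have fs s : uniq s -> \sum_(i <- s) sqnrm f i <= nrm v ^+ 2.
  move=> us; have [gs|gs] := boolP (g \in s).
    rewrite (bigD1_seq g) //= big1 => [|i /negbTE ig].
      by rewrite addr0 /sqnrm /f eqxx.
    by rewrite /sqnrm /f ig nrm0 expr0n.
  rewrite big1_seq ?sqr_ge0 // => i /= is_; rewrite /sqnrm /f.
  by case: eqP is_ => [->|_ _]; rewrite ?(negbTE gs) // nrm0 expr0n.
pose x := Ell2 (sfinP fs).
exists x; first by move=> i /negbTE ig; rewrite /= /f ig.
apply/eqP; rewrite eq_le; apply/andP; split.
  rewrite -(@ler_pXn2r _ 2) ?nnegrE ?nrm_ge0 // ell2_nrm2.
  by apply: ssum_le_bound => // i; exact: sqnrm_ge0.
by have := ell2_coord_le x g; rewrite /= /f eqxx.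
Qed.

End Graded.

Lemma nrm_cplane1 (R : realType) : nrm (1 : cplane R) = 1.
Proof. by rewrite /nrm normr1. Qed.

Section UniversalModels.
Variables (R : realType) (d : nat) (Theta : 'M[R]_d) (A : cstarAlgType R) (u : 'I_d -> A).
Hypothesis hu : is_universal_rel Theta u.

(* A representation graded by the lattice, as the regular one is, is faithful. *)
Lemma universal_graded_equiv (M : hilbertType R) (v : 'I_d -> bop (ell2 'rV[int]_d M))
    (x : M) : nrm x = 1 -> unitary_rel Theta v ->
  (forall l g y, at_index g y -> at_index (g + delta_mx 0 l) (v l y)) ->
  (forall l g y, at_index g y -> at_index (g - delta_mx 0 l) (star (v l) y)) ->
  tuple_equiv v u.
Proof.
move=> x1 vrel vU vV; case: hu => -[uu uc] ug univ.
have [f [fh fu]] := univ _ _ vrel.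
have -> : v = fun i => f (u i) by apply/funext => i; rewrite fu.
have [xi xi0 xi1] := at_index_vector (0 : 'rV[int]_d) x.
have pc i j : pcomm (u i) (u j).
  by exists (expi (Theta j i)); [exact: norm_expi|exact: uc].
apply: (@faithful_equiv _ _ _ u uu pc ug _ f fh (@at_index _ _ M) xi) => //.
- by move=> g h y z; exact: at_index_orth.
- by move=> i g y; rewrite fu; exact: vU.
- by move=> i g y; rewrite fu; exact: vV.
- by rewrite xi1.
Qed.

End UniversalModels.

(** * Columns and the operator norm *)

Section MatrixNorm.
Variables (R : realType) (d : nat) (D : 'M[R]_d).

(** A crude bound by row sums, so that the supremum defining the norm is a genuine one. *)
Let ub : has_ubound [set l2norm (D *m x) | x in [set x : 'cV[R]_d | l2norm x <= 1]].
Proof.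
exists (Num.sqrt (\sum_i (\sum_j `|D i j|) ^+ 2)) => _ [x /= x1 <-].
rewrite ler_wsqrtr //; apply: ler_sum => i _.
rewrite -real_normK ?num_real // lerXn2r ?nnegrE ?sumr_ge0 // mxE.
apply: le_trans (ler_norm_sum _ _ _) _; apply: ler_sum => j _.
rewrite normrM ler_piMr //; apply: le_trans x1.
rewrite -sqrtr_sqr ler_wsqrtr // (bigD1 j) //= lerDl sumr_ge0 // => k _.
exact: sqr_ge0.
Qed.

Lemma mx_opnorm_ge0 : 0 <= mx_opnorm D.
Proof.
have l0 : l2norm (0 : 'cV[R]_d) = 0.
  by rewrite /l2norm big1 ?sqrtr0 // => i _; rewrite mxE expr0n.
apply: ub_le_sup; first exact: ub.
by exists 0; rewrite /= ?mulmx0 l0.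
Qed.

Lemma col_le_opnorm l : \sum_j D j l ^+ 2 <= mx_opnorm D ^+ 2.
Proof.
have -> : \sum_j D j l ^+ 2 = l2norm (D *m delta_mx l 0) ^+ 2.
  rewrite sqr_sqrtr ?sumr_ge0 // => [|k _]; last exact: sqr_ge0.
  by apply: eq_bigr => j _; rewrite -colE mxE.
rewrite lerXn2r ?nnegrE ?mx_opnorm_ge0 ?sqrtr_ge0 //.
apply: ub_le_sup; first exact: ub.
exists (delta_mx l 0) => //=.
rewrite /l2norm (bigD1 l) //= mxE !eqxx big1 ?addr0 => [|i /negbTE il].
  by rewrite expr1n sqrtr1.
by rewrite mxE il expr0n.
Qed.

End MatrixNorm.

Unset Implicit Arguments.

Theorem corollary5p5 (R : realType) (d : nat) (Theta Theta' : 'M[R]_d)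
  (hTheta : Theta^T = - Theta) (hTheta' : Theta'^T = - Theta')
  (A : cstarAlgType R) (u : 'I_d -> A) (hu : is_universal_rel Theta u)
  (A' : cstarAlgType R) (u' : 'I_d -> A') (hu' : is_universal_rel Theta' u') :
  (d_HR u u' <= (28 * Num.sqrt (mx_opnorm (Theta - Theta')))%:E)%E.
Proof.
set rho := mx_opnorm _; have rho0 : 0 <= rho := mx_opnorm_ge0 _.
pose D := Theta' - Theta.
have Da : D^T = - D by rewrite /D linearB /= hTheta hTheta' opprB opprK addrC.
have Dl l : \sum_j D j l ^+ 2 <= rho ^+ 2.
  apply: le_trans (col_le_opnorm (Theta - Theta') l); rewrite le_eqVlt; apply/orP; left.
  by apply/eqP; apply: eq_bigr => j _; rewrite !mxE -sqrrN opprB.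
have [W [Wu Wd]] := phase_field Da rho0 Dl.
pose M := ell2 nat (cplane R).
have [m0 _ m1] := @at_index_vector R nat (cplane R) 0%N 1.
rewrite nrm_cplane1 in m1.
pose U := twisted_shift M Theta; pose V := twisted_shift M Theta'.
have idb : bijective (fun g : 'rV[int]_d => g) by exists id.
have W1 g : nrm (W g) <= 1 by case: (Wu g) => /nrm_isometry_le.
have W1' g : nrm (star (W g)) <= 1 by rewrite nrm_star W1.
pose Y := wshift W1 idb; pose Y' := wshift W1' idb.
have YE x g : Y x g = W g (x g) by [].
have Y'E x g : Y' x g = star (W g) (x g) by [].
have YY' : Y * Y' = 1.
  apply: bop_ext => x; apply: ell2_ext => g; change ((W g * star (W g)) (x g) = x g).
  by case: (Wu g) => _ ->.
have Yi x : nrm (Y x) = nrm x.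
  apply: (ell2_isometry idb) => g; rewrite YE isometry_nrm //.
  by case: (Wu g).
have Ys : star Y = Y' := isometry_inv_star Yi YY'.
have Yu : unitary Y := surj_isometry_unitary Yi YY'.
(* [Y] preserves every fibre, so the conjugates satisfy the same relations and shift the degree as
   before; they remain a faithful model. *)
pose V' l := star Y * V l * Y.
have [Vu Vc] := twisted_shift_rel M hTheta'.
have V'rel : unitary_rel Theta' V'.
  split=> [l|k l].
    by apply: unitaryM => //; apply: unitaryM => //; exact: unitary_star.
  have V'M a b : V' a * V' b = star Y * (V a * V b) * Y.
    by rewrite /V' !mulrA -(mulrA _ Y (star Y)); case: Yu => _ ->; rewrite mulr1.
  by rewrite (V'M l k) (V'M k l) (Vc k l) mulZr mulZl.
have shU T l g y : at_index g y -> at_index (g + delta_mx 0 l) (twisted_shift M T l y).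
  move=> yg i ig; rewrite twisted_shiftE yg ?scaler0 //.
  by apply: contra ig => /eqP <-; rewrite subrK.
have shV T (Ta : T^T = - T) l g y : at_index g y ->
    at_index (g - delta_mx 0 l) (star (twisted_shift M T l) y).
  move=> yg i ig; rewrite twisted_shift_star yg ?scaler0 //.
  by apply: contra ig => /eqP <-; rewrite addrK.
have gY g y : at_index g y -> at_index g (Y y).
  by move=> yg i ig; rewrite YE yg // bop0.
have gY' g y : at_index g y -> at_index g (star Y y).
  by move=> yg i ig; rewrite Ys Y'E yg // bop0.
have eU : tuple_equiv U u.
  apply: (universal_graded_equiv hu m1 (twisted_shift_rel M hTheta)) => l g y.
    exact: shU.
  exact: shV.
have eV : tuple_equiv V' u'.
  apply: (universal_graded_equiv hu' m1 V'rel) => l g y yg.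
    exact/gY'/shU/gY.
  by rewrite /V' !starM starK mulrA; exact/gY'/shV/gY.
apply: (@le_trans _ _ (tuple_norm (fun i => U i - V' i))%:E).
  by apply: ereal_inf_lbound; exists (ell2 'rV[int]_d M), U, V'.
rewrite lee_fin; apply: bigmax_le => [|l _]; first by rewrite mulr_ge0 ?sqrtr_ge0.
(* Up to a unitary factor the distance is the intertwining defect of [Y], which acts from fibre to
   fibre. *)
have -> : U l - V' l = star Y * (Y * U l - V l * Y).
  by rewrite mulrBr !mulrA; case: Yu => -> _; rewrite mul1r.
apply: le_trans (nrmM _ _) _.
have Y1 : nrm (star Y) <= 1 by rewrite nrm_star; case: Yu => /nrm_isometry_le.
rewrite -[leRHS]mul1r ler_pM ?nrm_ge0 //.
apply: bop_nrm_le => [|x]; first by rewrite mulr_ge0 ?sqrtr_ge0.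
have sb := bij_addr (- delta_mx 0 l : 'rV[int]_d).
apply: (ell2_le sb) => [|i]; first by rewrite mulr_ge0 ?sqrtr_ge0.
set g := i - delta_mx 0 l.
(* The phase for Theta' is the one for Theta plus the one for [D]; taking out the former leaves the
   defect bounded by [Wd]. *)
have -> : (Y * U l - V l * Y) x i =
    (expi (row_phase Theta l g) *: (W (g + delta_mx 0 l) - expi (row_phase D l g) *: W g)) (x g).
  change (W i (U l x i) - V l (Y x) i =
    expi (row_phase Theta l g) *: (W (g + delta_mx 0 l) (x g) - expi (row_phase D l g) *: W g (x g))).
  rewrite subrK !twisted_shiftE YE -/g bopZ scalerBr scalerA -expiD.
  congr (_ - expi _ *: _); rewrite /row_phase -mulrDr -big_split /=; congr (_ * _).
  by apply: eq_bigr => j _; rewrite /D !mxE; ring.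
apply: le_trans (opnorm_le _ _) _; rewrite ler_wpM2r ?nrm_ge0 // -nrm_bop.
by rewrite nrmZ norm_expi mul1r; exact: Wd.
Qed.
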